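(* Let $m\in\mathbb{Z}$ with $|m|\ge 1$, let $\lambda\in\left(0,\tfrac32 k_{\max}\right)$, and let $R>0$ satisfy $$\frac{12\left(1+m^2(2\ln 2-1)\right)}{\lambda}\le R^2.$$ Then there exists a solution pair $(A,\lambda)$, with this prescribed $\lambda$ and with $A(r)>0$ for all $r\in(0,R)$, of the boundary value problem $$\frac{d^2A}{dr^2}+\frac1r\frac{dA}{dr}-\frac{m^2}{r^2}A-\lambda A+\frac{A^3}{(1+A^2)^2}=0,\quad r\in(0,R),\qquad A(0)=0=A(R).$$
   Context: The constant $k_{\max}$ is the maximum value over $b\in\mathbb{R}\setminus\{0\}$ of $$k(b)=\frac{1}{b^2}\left(\ln(1+b^2)+\frac{3}{b}\tan^{-1}(b)-3\right),$$ so $k_{\max}\approx 0.0675407$, attained at $b\approx\pm 1.99379$. A solution pair $(A,\lambda)$ consists of a real number $\lambda$ (the nonlinear frequency shift) and a real-valued function $A$, continuous on $[0,R]$ and twice differentiable on $(0,R)$, satisfying the differential equation on $(0,R)$ and the boundary conditions. *)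

(* Defs.v *)
From Stdlib Require Import Reals Lra.
From Coquelicot Require Import Coquelicot.
Open Scope R_scope.

Definition k (b : R) : R :=
  1 / b ^ 2 * (ln (1 + b ^ 2) + 3 / b * atan b - 3).

(* The supremum of k over the nonzero reals; it is attained, as proved in
   [kmax_is_maximum] below. *)
Definition kmax : R := real (Lub_Rbar (fun y => exists b, b <> 0 /\ y = k b)).

(* Only the values of A on [0, rho] matter: [continuous_on] takes limits within
   the closed interval, and the derivatives are taken at interior points. *)
Definition solution_pair (m : Z) (rho : R) (A : R -> R) (lambda : R) : Prop :=
  continuous_on (fun r => 0 <= r <= rho) A /\
  (forall r, 0 < r < rho -> ex_derive A r /\ ex_derive (Derive A) r) /\
  (forall r, 0 < r < rho ->
     Derive_n A 2 r + 1 / r * Derive A r - (IZR m) ^ 2 / r ^ 2 * A r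
       - lambda * A r + (A r) ^ 3 / (1 + (A r) ^ 2) ^ 2 = 0) /\
  A 0 = 0 /\ A rho = 0.

Lemma k_even (b : R) : b <> 0 -> k (- b) = k b.
Proof.
intros hb; unfold k; rewrite atan_opp.
replace ((- b) ^ 2) with (b ^ 2) by ring.
f_equal; f_equal; f_equal; field; exact hb.
Qed.

Lemma atan_le_poly (x : R) : 0 < x -> atan x <= x - x ^ 3 / 3 + x ^ 5 / 5.
Proof.
intros hx.
destruct (MVT_cor2 (fun x => x - x ^ 3 / 3 + x ^ 5 / 5 - atan x)
  (fun x => 1 - x ^ 2 + x ^ 4 - / (1 + x ^ 2)) 0 x hx) as [c [hc _]].
- intros c _; apply is_derive_Reals; auto_derive; trivial.
  field; nra.
- assert (hg : 0 <= 1 - c ^ 2 + c ^ 4 - / (1 + c ^ 2)).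
  { replace (1 - c ^ 2 + c ^ 4 - / (1 + c ^ 2))
      with ((c ^ 3) ^ 2 * / (1 + c ^ 2)) by (field; nra).
    apply Rmult_le_pos; [apply pow2_ge_0 |].
    left; apply Rinv_0_lt_compat; nra. }
  rewrite atan_0 in hc.
  assert (0 <= (1 - c ^ 2 + c ^ 4 - / (1 + c ^ 2)) * (x - 0))
    by (apply Rmult_le_pos; lra).
  simpl in hc; simpl in *; lra.
Qed.

Lemma k_le_small (b : R) : 0 < b -> k b <= 3 / 5 * b ^ 2.
Proof.
intros hb.
assert (hb2 : 0 < b ^ 2) by (apply pow_lt; exact hb).
assert (hl : ln (1 + b ^ 2) <= b ^ 2).
{ rewrite <- (ln_exp (b ^ 2)) at 2; apply ln_le; [lra | apply exp_ineq1_le]. }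
assert (ha : 3 / b * atan b <= 3 / b * (b - b ^ 3 / 3 + b ^ 5 / 5)).
{ apply Rmult_le_compat_l; [| apply atan_le_poly; exact hb].
  left; apply Rdiv_lt_0_compat; lra. }
unfold k; apply Rle_trans with (1 / b ^ 2 *
  (b ^ 2 + 3 / b * (b - b ^ 3 / 3 + b ^ 5 / 5) - 3)).
- apply Rmult_le_compat_l; [left; apply Rdiv_lt_0_compat |]; lra.
- right; field; lra.
Qed.

Lemma k_le_large (b : R) : 0 < b -> k b <= 2 / b.
Proof.
intros hb.
assert (hb2 : 0 < b ^ 2) by (apply pow_lt; exact hb).
assert (hl : ln (1 + b ^ 2) <= 2 * b).
{ rewrite <- (ln_exp (2 * b)); apply ln_le; [lra |].
  replace (2 * b) with (b + b) by ring; rewrite exp_plus.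
  pose proof (exp_ineq1_le b); nra. }
assert (ha : 3 / b * atan b <= 3 / b * b).
{ apply Rmult_le_compat_l; [left; apply Rdiv_lt_0_compat; lra |].
  destruct (MVT_cor2 (fun x => x - atan x) (fun x => 1 - / (1 + x ^ 2)) 0 b hb)
    as [c [hc _]].
  - intros c _; apply is_derive_Reals; auto_derive; trivial.
    field; nra.
  - rewrite atan_0 in hc.
    assert (/ (1 + c ^ 2) <= 1)
      by (rewrite <- Rinv_1; apply Rinv_le_contravar; nra).
    nra. }
unfold k; apply Rle_trans with (1 / b ^ 2 * (2 * b + 3 / b * b - 3)).
- apply Rmult_le_compat_l; [left; apply Rdiv_lt_0_compat |]; lra.
- right; field; lra.
Qed.

Lemma k_exp2_pos : 0 < k (exp 2).
Proof.
pose proof (exp_pos 2) as he.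
assert (he2 : 0 < exp 2 ^ 2) by (apply pow_lt; exact he).
unfold k; apply Rmult_lt_0_compat; [apply Rdiv_lt_0_compat; lra |].
assert (ha : 0 < 3 / exp 2 * atan (exp 2)).
{ apply Rmult_lt_0_compat; [apply Rdiv_lt_0_compat; lra |].
  rewrite <- atan_0; apply atan_increasing; exact he. }
assert (hl : 4 < ln (1 + exp 2 ^ 2)).
{ rewrite <- (ln_exp 4) at 1; apply ln_increasing; [apply exp_pos |].
  replace 4 with (2 + 2) by ring; rewrite exp_plus; simpl; lra. }
lra.
Qed.

Lemma k_has_maximum : exists b, b <> 0 /\ forall c, c <> 0 -> k c <= k b.
Proof.
pose proof k_exp2_pos as hv; set (v := k (exp 2)) in *.
pose proof (exp_ineq1_le 2) as he.
set (d := Rmin v 1); set (M := Rmax (exp 2) (2 / v)).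
assert (hd : 0 < d) by (apply Rmin_glb_lt; lra).
assert (hd1 : d <= 1) by apply Rmin_r.
assert (hdv : d <= v) by apply Rmin_l.
assert (hM : exp 2 <= M) by apply Rmax_l.
assert (hMv : 2 / v <= M) by apply Rmax_r.
destruct (continuity_ab_maj k d M) as [b [hmax hb]]; [lra | |].
{ intros c hc; apply derivable_continuous_pt, ex_derive_Reals_0.
  unfold k; auto_derive; repeat split; nra. }
assert (hvb : v <= k b) by (apply hmax; lra).
assert (hpos : forall c, 0 < c -> k c <= k b).
{ intros c hc; destruct (Rle_or_lt d c) as [hdc | hdc].
  - destruct (Rle_or_lt c M) as [hcM | hcM]; [apply hmax; lra |].
    apply Rle_trans with v; [| exact hvb].
    apply Rle_trans with (2 / c); [apply k_le_large; exact hc |].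
    apply Rle_div_l; [exact hc |].
    assert (h : 2 / v <= c) by lra.
    apply Rle_div_l in h; [lra | exact hv].
  - apply Rle_trans with v; [| exact hvb].
    apply Rle_trans with (3 / 5 * c ^ 2); [apply k_le_small; exact hc | nra]. }
exists b; split; [lra |].
intros c hc; destruct (Rle_or_lt c 0) as [h | h]; [| apply hpos; exact h].
rewrite <- k_even by exact hc; apply hpos; lra.
Qed.

Lemma kmax_is_maximum :
  (exists b, b <> 0 /\ k b = kmax) /\ (forall b, b <> 0 -> k b <= kmax).
Proof.
destruct k_has_maximum as [b [hb hmax]].
assert (h : kmax = k b).
{ unfold kmax; rewrite (is_lub_Rbar_unique _ (Finite (k b))); [reflexivity |].
  split.
  - intros y [c [hc ->]]; exact (hmax c hc).
  - intros l hl; apply hl; exists b; split; [exact hb | reflexivity]. }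
rewrite h; split; [exists b; split; [exact hb | reflexivity] | exact hmax].
Qed.

(* Main.v *)
Require Import Defs.
From Stdlib Require Import Reals Lra Lia ZArith Classical.
From Coquelicot Require Import Coquelicot.
Open Scope R_scope.

(** Write [f a = a ^ 3 / (1 + a ^ 2) ^ 2] and [F] for its primitive vanishing at
    [0]. The equation is the Euler-Lagrange equation of the action
    [I A = int_0^rho r * ((A' ^ 2 + m ^ 2 / r ^ 2 * A ^ 2 + lambda * A ^ 2) / 2 - F A)].
    On a tent function of height [h] with its apex at [rho / 2], the action is
    [h ^ 2 * (1 + m ^ 2 * (2 * ln 2 - 1)) + rho ^ 2 * h ^ 2 * (lambda / 12 - k h / 4)],
    and the hypothesis on [rho] bounds this by
    [rho ^ 2 * h ^ 2 / 4 * (2 / 3 * lambda - k h)], which is negative when [h]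
    maximises [k]. So the trivial solution, of action [0], is not a minimiser. The
    proof turns this into a solution without any function space, by an iteration
    that is monotone and also decreases an energy.

    Adding [(pot - lambda) * A] to both sides gives [M A = g A] with
    [M = - A'' - A' / r + (m ^ 2 / r ^ 2 + pot) A] and
    [g A = f A + (pot - lambda) * A]. The potential [pot] is chosen large enough to
    make [g] increasing, and such that [phi r = r ^ n * exp (kap * r ^ 2)], with
    [n = |m|], solves [M phi = 0] (Bessel functions never appear). Writing
    [A = phi * w] turns [M A = b] into [- (r * phi ^ 2 * w')' = r * phi * b], which
    two integrations solve; the result is the order-preserving operator [green]
    ([green_solves], [green_le]).

    A large constant [s] is a supersolution because [f a / a] tends to [0]
    ([step_admissible]), so the iterates of [A |-> green (g A)] from [s] decrease.
    They are equi-Lipschitz ([green_lipschitz]), hence converge uniformly, and their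
    limit is a fixed point, that is, a solution. What remains is to show that it is
    not zero. The iterates that start from the tent stay below those that start from
    [s]. Along them the dual action
    [D A = int r * (g A * A - G A - g A * green (g A) / 2)], with [G' = g], does not
    increase ([dual_step_le]): [G] is convex and [green] is symmetric and positive
    semidefinite ([green_young]). On the tent, [D] is at most [I], hence negative
    ([tent_young], [dual_tent_neg]). If the limit were zero, the iterates of the
    tent would tend to zero uniformly, and [D] along them would have a nonnegative
    limit ([dual_ge_small]), a contradiction. Positivity on the whole interval is
    then read off the double integral ([green_pos]). *)

(** * Calculus lemmas *)

Ltac cont :=
  repeat first [assumption | match goal with
  | H : forall x, continuous ?f _ |- continuous ?f _ => apply H
  | H : forall x, continuous ?f _ |- continuous (fun y => ?f y) _ => apply H
  | |- continuous (fun _ => ?c) _ => apply continuous_const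
  | |- continuous (fun x => x) _ => apply continuous_id
  | |- continuous (fun x => @?f x * @?g x) _ => apply (continuous_mult f g)
  | |- continuous (fun x => @?f x + @?g x) _ => apply (continuous_plus f g)
  | |- continuous (fun x => @?f x - @?g x) _ => apply (continuous_minus f g)
  | |- continuous (fun x => @?f x ^ 2) _ => apply (continuous_mult f (fun x => f x * 1))
  | |- continuous (fun x => - @?f x) _ => apply (continuous_opp f)
  end].

Lemma ex_RInt_cont (f : R -> R) (a b : R) :
  (forall x, continuous f x) -> ex_RInt f a b.
Proof. intros hf; apply (ex_RInt_continuous (V := R_CompleteNormedModule)); intros; apply hf. Qed.

Lemma RInt_Rplus (f g : R -> R) (a b : R) :
  ex_RInt f a b -> ex_RInt g a b ->
  RInt (fun x => f x + g x) a b = RInt f a b + RInt g a b.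
Proof. exact (RInt_plus f g a b). Qed.

Lemma RInt_Rminus (f g : R -> R) (a b : R) :
  ex_RInt f a b -> ex_RInt g a b ->
  RInt (fun x => f x - g x) a b = RInt f a b - RInt g a b.
Proof. exact (RInt_minus f g a b). Qed.

Lemma RInt_Rscal (c : R) (f : R -> R) (a b : R) :
  ex_RInt f a b -> RInt (fun x => c * f x) a b = c * RInt f a b.
Proof. exact (RInt_scal f a b c). Qed.

Lemma RInt_Rext (f g : R -> R) (a b : R) :
  (forall x, Rmin a b < x < Rmax a b -> f x = g x) -> RInt f a b = RInt g a b.
Proof. exact (RInt_ext f g a b). Qed.

Lemma RInt_RChasles (f : R -> R) (a b c : R) :
  ex_RInt f a b -> ex_RInt f b c -> RInt f a c = RInt f a b + RInt f b c.
Proof. intros h1 h2; symmetry; exact (RInt_Chasles f a b c h1 h2). Qed.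

Lemma RInt_Rconst (c a b : R) : RInt (fun _ => c) a b = (b - a) * c.
Proof. exact (RInt_const a b c). Qed.

Lemma is_derive_RInt_cont (f : R -> R) (a x : R) :
  (forall x, continuous f x) -> is_derive (fun y => RInt f a y) x (f x).
Proof.
intros hf; apply (is_derive_RInt f (fun y => RInt f a y) a x); [| apply hf].
apply filter_forall; intros y; apply (RInt_correct f), ex_RInt_cont, hf.
Qed.

Lemma nondecreasing_of_derive (f df : R -> R) (a b : R) :
  a <= b -> (forall x, a <= x <= b -> is_derive f x (df x)) ->
  (forall x, a <= x <= b -> 0 <= df x) -> f a <= f b.
Proof.
intros hab hd hpos.
destruct (MVT_gen f a b df) as [c [hc he]].
- rewrite Rmin_left, Rmax_right by lra; intros x hx; apply hd; lra.
- rewrite Rmin_left, Rmax_right by lra; intros x hx.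
  apply continuity_pt_filterlim, (ex_derive_continuous f x).
  exists (df x); apply hd; lra.
- rewrite Rmin_left, Rmax_right in hc by lra.
  pose proof (hpos c hc); assert (0 <= df c * (b - a)) by (apply Rmult_le_pos; lra).
  lra.
Qed.

(** The boundary terms at the singular endpoint [0] are handled by working on
    [[a, rho]] and letting [a] tend to [0] in a lower bound [J a]. *)
Lemma le_at_0_of_le_right (J : R -> R) (X d : R) :
  0 < d -> continuous J 0 -> (forall a, 0 < a < d -> J a <= X) -> J 0 <= X.
Proof.
intros hd hJ hle; apply Rnot_lt_le; intros hlt.
destruct (proj1 (filterlim_locally J (J 0)) hJ
  (mkposreal (J 0 - X) (proj2 (Rlt_0_minus _ _) hlt))) as [e he].
set (a := Rmin (d / 2) (e / 2)).
pose proof (cond_pos e) as hepos.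
assert (ha : 0 < a) by (apply Rmin_glb_lt; lra).
assert (a <= d / 2) by apply Rmin_l.
assert (a <= e / 2) by apply Rmin_r.
assert (hb : ball 0 e a).
{ change (Rabs (a - 0) < e); rewrite Rminus_0_r, Rabs_pos_eq; lra. }
specialize (he a hb); change (Rabs (J a - J 0) < J 0 - X) in he.
apply Rabs_def2 in he.
specialize (hle a); lra.
Qed.

(** * Inverting the linear part *)

Section Inverse.

Variables (n : nat) (kap rho : R).
Hypotheses (hn : (1 <= n)%nat) (hkap : 0 <= kap) (hrho : 0 < rho).

(** The increasing positive solution of
    [phi'' + phi' / r = (n ^ 2 / r ^ 2 + pot) * phi], where [pot] is defined below. *)
Definition phi (r : R) : R := r ^ n * exp (kap * r ^ 2).

(** The logarithmic derivative of [phi]. *)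
Definition logd (r : R) : R := INR n / r + 2 * kap * r.

Definition pot (r : R) : R := 4 * kap * (INR n + 1) + 4 * kap ^ 2 * r ^ 2.

(** If [A = phi * w] solves the linear equation with source [b] and is regular at
    [0], then [flux b s = - s * phi s ^ 2 * w' s]. *)
Definition flux (b : R -> R) (s : R) : R := RInt (fun t => t * phi t * b t) 0 s.

(** The quotient [w = A / phi] that vanishes at [rho]. *)
Definition quot (b : R -> R) (r : R) : R :=
  RInt (fun s => flux b s / (s * phi s ^ 2)) r rho.

(** The solution of the linear boundary value problem, extended by [0] so as to be
    continuous on the whole line. The value at [0] has to be imposed: for [n >= 2]
    the integral [quot b] may diverge there. *)
Definition green (b : R -> R) (r : R) : R :=
  if Rlt_dec 0 r then if Rlt_dec r rho then phi r * quot b r else 0 else 0.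

Lemma INR_n_ge_1 : 1 <= INR n.
Proof. apply (le_INR 1); exact hn. Qed.

Lemma phi_pos (r : R) : 0 < r -> 0 < phi r.
Proof.
intros hr; apply Rmult_lt_0_compat; [apply pow_lt; exact hr | apply exp_pos].
Qed.

Lemma phi_continuous (r : R) : continuous phi r.
Proof. apply (ex_derive_continuous phi); unfold phi; auto_derive; trivial. Qed.

Lemma phi_nonneg (r : R) : 0 <= r -> 0 <= phi r.
Proof.
intros hr; apply Rmult_le_pos; [apply pow_le; exact hr | left; apply exp_pos].
Qed.

Lemma phi_derive (r : R) : 0 < r -> is_derive phi r (logd r * phi r).
Proof.
intros hr; unfold phi, logd; auto_derive; trivial.
pose proof hn; destruct n as [| p]; [lia |].
change (Nat.pred (S p)) with p; rewrite <- (tech_pow_Rmult r p).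
replace (r * (r * 1)) with (r ^ 2) by ring.
generalize (INR (S p)) (exp (kap * r ^ 2)); intros N E; field; lra.
Qed.

Lemma phi_incr (t s : R) : 0 <= t <= s -> phi t <= phi s.
Proof.
intros hts; apply Rmult_le_compat.
- apply pow_le; lra.
- left; apply exp_pos.
- apply pow_incr; lra.
- assert (h : kap * t ^ 2 <= kap * s ^ 2)
    by (apply Rmult_le_compat_l; [exact hkap | apply pow_incr; exact hts]).
  destruct h as [h | ->]; [left; apply exp_increasing; exact h | lra].
Qed.

(** The quotient [phi r / r] is nondecreasing because [n >= 1]. This is what makes
    [green b] vanish linearly at [0], see [green_bound]. *)
Lemma phi_ratio (r s : R) : 0 < r <= s -> phi r * s <= phi s * r.
Proof.
intros hrs; unfold phi; pose proof hn; destruct n as [| p]; [lia |].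
rewrite <- (tech_pow_Rmult r p), <- (tech_pow_Rmult s p).
assert (r ^ p * exp (kap * r ^ 2) <= s ^ p * exp (kap * s ^ 2)).
{ apply Rmult_le_compat; [apply pow_le; lra | left; apply exp_pos
    | apply pow_incr; lra |].
  assert (h : kap * r ^ 2 <= kap * s ^ 2)
    by (apply Rmult_le_compat_l; [exact hkap | apply pow_incr; lra]).
  destruct h as [h | ->]; [left; apply exp_increasing; exact h | lra]. }
apply Rle_trans with (r * s * (r ^ p * exp (kap * r ^ 2))); [right; ring |].
apply Rle_trans with (r * s * (s ^ p * exp (kap * s ^ 2))); [| right; ring].
apply Rmult_le_compat_l; [apply Rmult_le_pos; lra | assumption].
Qed.

Lemma flux_integrand_continuous (b : R -> R) (x : R) :
  (forall x, continuous b x) -> continuous (fun t => t * phi t * b t) x.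
Proof. intros hb; pose proof phi_continuous; cont. Qed.

Lemma flux_derive (b : R -> R) (s : R) :
  (forall x, continuous b x) -> is_derive (flux b) s (s * phi s * b s).
Proof.
intros hb; apply (is_derive_RInt_cont (fun t => t * phi t * b t) 0 s).
intros x; apply flux_integrand_continuous, hb.
Qed.

Lemma flux_le (b1 b2 : R -> R) (s : R) :
  (forall x, continuous b1 x) -> (forall x, continuous b2 x) ->
  0 <= s <= rho -> (forall t, 0 <= t <= rho -> b1 t <= b2 t) ->
  flux b1 s <= flux b2 s.
Proof.
intros h1 h2 hs hle; apply RInt_le; [lra | | |].
1, 2: apply ex_RInt_cont; intros x; apply flux_integrand_continuous; assumption.
intros t ht; apply Rmult_le_compat_l; [| apply hle; lra].
apply Rmult_le_pos; [lra | apply phi_nonneg; lra].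
Qed.

Lemma flux_const_le (B s : R) : 0 <= B -> 0 <= s -> flux (fun _ => B) s <= B * s ^ 2 * phi s.
Proof.
intros hB hs; unfold flux.
apply Rle_trans with (RInt (fun _ => s * phi s * B) 0 s).
- apply RInt_le; [lra | | apply ex_RInt_const |].
  { apply ex_RInt_cont; intros x; apply flux_integrand_continuous; intros y; cont. }
  intros t ht; apply Rmult_le_compat_r; [exact hB |].
  apply Rmult_le_compat; [lra | apply phi_nonneg; lra | lra | apply phi_incr; lra].
- rewrite RInt_Rconst; right; ring.
Qed.

Lemma flux_zero (s : R) : flux (fun _ => 0) s = 0.
Proof.
unfold flux; rewrite (RInt_Rext _ (fun _ => 0)) by (intros; ring).
rewrite RInt_Rconst; ring.
Qed.

Lemma flux_nonneg (b : R -> R) (s : R) :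
  (forall x, continuous b x) -> (forall t, 0 <= t <= rho -> 0 <= b t) ->
  0 <= s <= rho -> 0 <= flux b s.
Proof.
intros hb hpos hs; rewrite <- (flux_zero s).
apply flux_le; try assumption; intros x; cont.
Qed.

Lemma flux_bound (b : R -> R) (B s : R) :
  (forall x, continuous b x) -> (forall t, 0 <= t <= rho -> 0 <= b t <= B) ->
  0 <= s <= rho -> flux b s <= B * s ^ 2 * phi s.
Proof.
intros hb hB hs; apply Rle_trans with (flux (fun _ => B) s).
- apply flux_le; try assumption; [intros x; cont | intros t ht; apply hB; exact ht].
- apply flux_const_le; [specialize (hB s hs) |]; lra.
Qed.

Lemma quot_integrand_continuous (b : R -> R) (s : R) :
  (forall x, continuous b x) -> 0 < s ->
  continuous (fun s => flux b s / (s * phi s ^ 2)) s.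
Proof.
intros hb hs; pose proof (phi_pos s hs) as hp.
apply (ex_derive_continuous (fun s => flux b s / (s * phi s ^ 2))).
apply ex_derive_div.
- exists (s * phi s * b s); apply flux_derive, hb.
- unfold phi; auto_derive; trivial.
- apply Rgt_not_eq, Rmult_lt_0_compat; [exact hs | apply pow_lt; exact hp].
Qed.

Lemma quot_ex_RInt (b : R -> R) (r s : R) :
  (forall x, continuous b x) -> 0 < r -> 0 < s ->
  ex_RInt (fun s => flux b s / (s * phi s ^ 2)) r s.
Proof.
intros hb hr hs; apply (ex_RInt_continuous (V := R_CompleteNormedModule)).
intros z hz; apply quot_integrand_continuous; [exact hb |].
apply Rlt_le_trans with (Rmin r s); [apply Rmin_glb_lt; assumption | apply hz].
Qed.

Lemma quot_derive (b : R -> R) (r : R) :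
  (forall x, continuous b x) -> 0 < r ->
  is_derive (quot b) r (- (flux b r / (r * phi r ^ 2))).
Proof.
intros hb hr.
apply (is_derive_RInt' (fun s => flux b s / (s * phi s ^ 2)) (quot b) r rho).
- exists (mkposreal r hr); intros y hy.
  change (Rabs (y - r) < r) in hy; apply Rabs_def2 in hy.
  apply (RInt_correct (fun s => flux b s / (s * phi s ^ 2))).
  apply quot_ex_RInt; [exact hb | lra | exact hrho].
- apply quot_integrand_continuous; assumption.
Qed.

Lemma quot_rho (b : R -> R) : quot b rho = 0.
Proof. exact (RInt_point (V := R_CompleteNormedModule) rho _). Qed.

Lemma quot_integrand_nonneg (b : R -> R) (s : R) :
  (forall x, continuous b x) -> (forall t, 0 <= t <= rho -> 0 <= b t) ->
  0 < s <= rho -> 0 <= flux b s / (s * phi s ^ 2).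
Proof.
intros hb hpos hs; pose proof (phi_pos s ltac:(lra)) as hp.
apply Rmult_le_pos; [apply flux_nonneg; try assumption; lra |].
left; apply Rinv_0_lt_compat, Rmult_lt_0_compat; [lra | apply pow_lt; exact hp].
Qed.

Lemma green_inside (b : R -> R) (r : R) :
  0 < r <= rho -> green b r = phi r * quot b r.
Proof.
intros hr; unfold green; destruct (Rlt_dec 0 r); [| lra].
destruct (Rlt_dec r rho); [reflexivity |].
replace r with rho by lra; rewrite quot_rho; ring.
Qed.

Lemma green_outside (b : R -> R) (r : R) : r <= 0 \/ rho <= r -> green b r = 0.
Proof.
intros hr; unfold green; destruct (Rlt_dec 0 r); [| reflexivity].
destruct (Rlt_dec r rho); [lra | reflexivity].
Qed.

Lemma green_le (b1 b2 : R -> R) (r : R) :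
  (forall x, continuous b1 x) -> (forall x, continuous b2 x) ->
  (forall t, 0 <= t <= rho -> b1 t <= b2 t) -> green b1 r <= green b2 r.
Proof.
intros h1 h2 hle; unfold green.
destruct (Rlt_dec 0 r) as [hr |]; [| lra].
destruct (Rlt_dec r rho) as [hr' |]; [| lra].
apply Rmult_le_compat_l; [apply phi_nonneg; lra |].
apply RInt_le; [lra | | |]; try (apply quot_ex_RInt; assumption).
intros s hs; apply Rmult_le_compat_r.
- left; apply Rinv_0_lt_compat, Rmult_lt_0_compat; [lra |].
  apply pow_lt, phi_pos; lra.
- apply flux_le; try assumption; lra.
Qed.

Lemma green_nonneg (b : R -> R) (r : R) :
  (forall x, continuous b x) -> (forall t, 0 <= t <= rho -> 0 <= b t) ->
  0 <= green b r.
Proof.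
intros hb hpos; unfold green.
destruct (Rlt_dec 0 r) as [hr |]; [| lra].
destruct (Rlt_dec r rho) as [hr' |]; [| lra].
apply Rmult_le_pos; [apply phi_nonneg; lra |].
apply RInt_ge_0; [lra | apply quot_ex_RInt; assumption |].
intros s hs; apply quot_integrand_nonneg; try assumption; lra.
Qed.

(** The integrand of [quot b] is at most [B * s / phi s], and
    [phi r * s / phi s <= r] for [r <= s]. *)
Lemma green_bound (b : R -> R) (B r : R) :
  (forall x, continuous b x) -> (forall t, 0 <= t <= rho -> 0 <= b t <= B) ->
  0 <= r <= rho -> green b r <= B * r * (rho - r).
Proof.
intros hb hB hr.
assert (hB0 : 0 <= B) by (specialize (hB r hr); lra).
destruct (Req_dec r 0) as [-> | hr0]; [rewrite green_outside; lra |].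
rewrite green_inside by lra.
unfold quot; rewrite <- RInt_Rscal by (apply quot_ex_RInt; [assumption | lra | lra]).
apply Rle_trans with (RInt (fun _ => B * r) r rho);
  [| rewrite RInt_Rconst; right; ring].
apply RInt_le; [lra | | apply ex_RInt_const |].
{ apply (ex_RInt_scal (fun s => flux b s / (s * phi s ^ 2))).
  apply quot_ex_RInt; [assumption | lra | lra]. }
intros s hs.
pose proof (phi_pos s ltac:(lra)) as hp.
pose proof (phi_pos r ltac:(lra)) as hpr.
apply Rle_trans with (phi r * (B * s ^ 2 * phi s / (s * phi s ^ 2))).
- apply Rmult_le_compat_l; [lra |].
  apply Rmult_le_compat_r; [| apply flux_bound; try assumption; lra].
  left; apply Rinv_0_lt_compat, Rmult_lt_0_compat; [lra | apply pow_lt; exact hp].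
- replace (phi r * (B * s ^ 2 * phi s / (s * phi s ^ 2)))
    with (B * (phi r * s / phi s)) by (field; lra).
  apply Rmult_le_compat_l; [exact hB0 |].
  apply Rle_div_l; [exact hp |]; pose proof (phi_ratio r s); lra.
Qed.

Lemma green_derive (b : R -> R) (r : R) :
  (forall x, continuous b x) -> 0 < r < rho ->
  is_derive (green b) r (logd r * green b r - flux b r / (r * phi r)).
Proof.
intros hb hr; pose proof (phi_pos r (proj1 hr)) as hp.
apply (is_derive_ext_loc (fun x => phi x * quot b x)).
- apply (locally_interval _ r 0 rho); simpl; try lra.
  intros y h0 h1; simpl in *; symmetry; apply green_inside; lra.
- rewrite green_inside by lra.
  replace (logd r * (phi r * quot b r) - flux b r / (r * phi r))
    with (logd r * phi r * quot b r + phi r * - (flux b r / (r * phi r ^ 2)))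
    by (field; lra).
  apply (is_derive_mult phi (quot b)); [apply phi_derive; lra | | exact Rmult_comm].
  apply quot_derive; [exact hb | lra].
Qed.

Definition green_lip (B : R) : R := B * rho * (INR n + 2 * kap * rho ^ 2 + 1).

Lemma green_derive_bound (b : R -> R) (B r : R) :
  (forall x, continuous b x) -> (forall t, 0 <= t <= rho -> 0 <= b t <= B) ->
  0 < r < rho ->
  Rabs (logd r * green b r - flux b r / (r * phi r)) <= green_lip B.
Proof.
intros hb hB hr; pose proof (phi_pos r (proj1 hr)) as hp.
assert (hB0 : 0 <= B) by (specialize (hB r ltac:(lra)); lra).
pose proof INR_n_ge_1 as hn1.
assert (hpos : forall t, 0 <= t <= rho -> 0 <= b t) by (intros; apply hB; assumption).
pose proof (green_nonneg b r hb hpos) as hg0.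
pose proof (green_bound b B r hb hB ltac:(lra)) as hg1.
assert (hf0 : 0 <= flux b r / (r * phi r)).
{ apply Rmult_le_pos; [apply flux_nonneg; try assumption; lra |].
  left; apply Rinv_0_lt_compat, Rmult_lt_0_compat; lra. }
assert (hf1 : flux b r / (r * phi r) <= B * r).
{ apply Rle_div_l; [apply Rmult_lt_0_compat; lra |].
  pose proof (flux_bound b B r hb hB ltac:(lra)); lra. }
assert (hl0 : 0 <= logd r).
{ unfold logd; apply Rplus_le_le_0_compat.
  - apply Rmult_le_pos; [lra | left; apply Rinv_0_lt_compat; lra].
  - apply Rmult_le_pos; lra. }
assert (hl1 : logd r * (B * r * (rho - r)) <= B * rho * (INR n + 2 * kap * rho ^ 2)).
{ replace (logd r * (B * r * (rho - r)))
    with (B * ((rho - r) * (INR n + 2 * kap * r ^ 2)))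
    by (unfold logd; field; lra).
  rewrite (Rmult_assoc B rho); apply Rmult_le_compat_l; [exact hB0 |].
  assert (kap * r ^ 2 <= kap * rho ^ 2)
    by (apply Rmult_le_compat_l; [exact hkap | apply pow_incr; lra]).
  assert (0 <= kap * r ^ 2)
    by (apply Rmult_le_pos; [exact hkap | apply pow2_ge_0]).
  apply Rmult_le_compat; lra. }
assert (hlg : 0 <= logd r * green b r) by (apply Rmult_le_pos; assumption).
assert (logd r * green b r <= logd r * (B * r * (rho - r)))
  by (apply Rmult_le_compat_l; assumption).
assert (B * r <= B * rho) by (apply Rmult_le_compat_l; lra).
assert (0 <= B * rho * (INR n + 2 * kap * rho ^ 2)).
{ apply Rle_trans with (2 := hl1); lra. }
assert (0 <= B * rho) by (apply Rmult_le_pos; lra).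
unfold green_lip; apply Rabs_le; lra.
Qed.

(** Inside the interval the derivative is bounded; across an endpoint the bound
    [B * r * (rho - r)] takes over. *)
Lemma green_lipschitz_lt (b : R -> R) (B x y : R) :
  (forall x, continuous b x) -> (forall t, 0 <= t <= rho -> 0 <= b t <= B) ->
  x < y -> Rabs (green b x - green b y) <= green_lip B * (y - x).
Proof.
intros hb hB hxy.
assert (hpos : forall t, 0 <= t <= rho -> 0 <= b t) by (intros; apply hB; assumption).
assert (hB0 : 0 <= B) by (specialize (hB 0 ltac:(lra)); lra).
assert (hend : B * rho <= green_lip B).
{ unfold green_lip; pose proof INR_n_ge_1.
  assert (0 <= kap * rho ^ 2)
    by (apply Rmult_le_pos; [exact hkap | apply pow2_ge_0]).
  assert (0 <= B * rho) by (apply Rmult_le_pos; lra).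
  nra. }
assert (hL : 0 <= green_lip B)
  by (apply Rle_trans with (2 := hend); apply Rmult_le_pos; lra).
assert (hL' : 0 <= green_lip B * (y - x)) by (apply Rmult_le_pos; lra).
destruct (Rle_or_lt y 0) as [hy | hy].
{ rewrite !green_outside, Rminus_0_r, Rabs_R0 by lra; exact hL'. }
destruct (Rle_or_lt rho x) as [hx | hx].
{ rewrite !green_outside, Rminus_0_r, Rabs_R0 by lra; exact hL'. }
pose proof (green_nonneg b x hb hpos) as hgx.
pose proof (green_nonneg b y hb hpos) as hgy.
assert (hLend : B * rho * (y - x) <= green_lip B * (y - x))
  by (apply Rmult_le_compat_r; lra).
destruct (Rle_or_lt x 0) as [hx0 | hx0].
- rewrite (green_outside b x), Rminus_0_l, Rabs_Ropp, Rabs_pos_eq by lra.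
  destruct (Rle_or_lt rho y) as [hy' | hy'].
  { rewrite green_outside by lra; exact hL'. }
  pose proof (green_bound b B y hb hB ltac:(lra)).
  assert (B * (y * (rho - y)) <= B * (rho * (y - x)))
    by (apply Rmult_le_compat_l; [exact hB0 | nra]).
  lra.
- destruct (Rle_or_lt rho y) as [hy' | hy'].
  + rewrite (green_outside b y), Rminus_0_r, Rabs_pos_eq by lra.
    pose proof (green_bound b B x hb hB ltac:(lra)).
    assert (B * (x * (rho - x)) <= B * (rho * (y - x)))
      by (apply Rmult_le_compat_l; [exact hB0 | nra]).
    lra.
  + destruct (MVT_gen (green b) x y
      (fun r => logd r * green b r - flux b r / (r * phi r))) as [c [hc he]].
    * rewrite Rmin_left, Rmax_right by lra; intros r hr.
      apply green_derive; [exact hb | lra].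
    * rewrite Rmin_left, Rmax_right by lra; intros r hr.
      apply continuity_pt_filterlim, (ex_derive_continuous (green b)).
      eexists; apply green_derive; [exact hb | lra].
    * rewrite Rmin_left, Rmax_right in hc by lra.
      rewrite Rabs_minus_sym, he, Rabs_mult, (Rabs_pos_eq (y - x)) by lra.
      apply Rmult_le_compat_r; [lra |].
      apply green_derive_bound; try assumption; lra.
Qed.

Lemma green_lipschitz (b : R -> R) (B x y : R) :
  (forall x, continuous b x) -> (forall t, 0 <= t <= rho -> 0 <= b t <= B) ->
  Rabs (green b x - green b y) <= green_lip B * Rabs (x - y).
Proof.
intros hb hB; destruct (Rtotal_order x y) as [h | [-> | h]].
- rewrite (Rabs_minus_sym x y), (Rabs_pos_eq (y - x)) by lra.
  apply green_lipschitz_lt; assumption.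
- rewrite !Rminus_diag, Rabs_R0; lra.
- rewrite Rabs_minus_sym, (Rabs_pos_eq (x - y)) by lra.
  apply green_lipschitz_lt; assumption.
Qed.

Lemma lipschitz_continuous (f : R -> R) (L x : R) :
  (forall y z, Rabs (f y - f z) <= L * Rabs (y - z)) -> continuous f x.
Proof.
intros hL; apply continuity_pt_filterlim.
intros e he; exists (e / (Rabs L + 1)).
pose proof (Rabs_pos L); split; [apply Rdiv_lt_0_compat; lra |].
intros y [_ hy]; simpl in *; unfold Rdist in *.
apply Rle_lt_trans with (1 := hL y x).
pose proof (Rle_abs L); pose proof (Rabs_pos (y - x)).
apply Rlt_div_r in hy; [| lra]; nra.
Qed.

Lemma green_continuous (b : R -> R) (B x : R) :
  (forall x, continuous b x) -> (forall t, 0 <= t <= rho -> 0 <= b t <= B) ->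
  continuous (green b) x.
Proof.
intros hb hB; apply lipschitz_continuous with (green_lip B).
intros y z; apply green_lipschitz; assumption.
Qed.

Lemma pot_continuous (r : R) : continuous pot r.
Proof. apply (ex_derive_continuous pot); unfold pot; auto_derive; trivial. Qed.

(** The two sides differ by the integral of [n ^ 2 / r * phi r], since
    [(r * phi')' = (n ^ 2 / r + r * pot) * phi]. *)
Lemma flux_pot_le (s : R) : 0 < s -> flux pot s <= s * logd s * phi s.
Proof.
intros hs.
set (D := fun r => (INR n + 2 * kap * r ^ 2) * phi r - flux pot r).
replace (s * logd s * phi s) with (D s + flux pot s)
  by (unfold D, logd; field; lra).
enough (0 <= D s) by lra.
assert (h0 : D 0 = 0).
{ assert (hf : flux pot 0 = 0)
    by exact (RInt_point (V := R_CompleteNormedModule) 0 _).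
  unfold D, phi; rewrite hf, (pow_i n) by exact hn; ring. }
assert (hc : continuous D 0).
{ unfold D; pose proof phi_continuous.
  assert (forall x, continuous (flux pot) x).
  { intros x; apply (ex_derive_continuous (flux pot)); eexists.
    apply flux_derive, pot_continuous. }
  assert (continuous (fun r => INR n + 2 * kap * r ^ 2) 0)
    by (apply (ex_derive_continuous (fun r => INR n + 2 * kap * r ^ 2));
        auto_derive; trivial).
  cont. }
rewrite <- h0; apply le_at_0_of_le_right with s; [exact hs | exact hc |].
intros a ha.
apply nondecreasing_of_derive with
  (fun r => 4 * kap * r * phi r + (INR n + 2 * kap * r ^ 2) * (logd r * phi r)
    - r * phi r * pot r); [lra | |].
- intros r hr; unfold D.
  apply (is_derive_minus (fun r => (INR n + 2 * kap * r ^ 2) * phi r) (flux pot)).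
  + apply (is_derive_mult (fun r => INR n + 2 * kap * r ^ 2) phi);
      [| apply phi_derive; lra | exact Rmult_comm].
    auto_derive; trivial; ring.
  + apply flux_derive, pot_continuous.
- intros r hr; pose proof (phi_pos r ltac:(lra)) as hp.
  replace (4 * kap * r * phi r + (INR n + 2 * kap * r ^ 2) * (logd r * phi r)
    - r * phi r * pot r) with (INR n ^ 2 / r * phi r)
    by (unfold logd, pot; field; lra).
  apply Rmult_le_pos; [| lra].
  apply Rmult_le_pos; [apply pow2_ge_0 | left; apply Rinv_0_lt_compat; lra].
Qed.

(** A constant [c] is a supersolution of the linear problem with source
    [c * pot], since the centrifugal term has the favourable sign. *)
Lemma green_pot_le (c r : R) : 0 <= c -> green (fun t => c * pot t) r <= c.
Proof.
intros hc; unfold green.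
destruct (Rlt_dec 0 r) as [hr |]; [| lra].
destruct (Rlt_dec r rho) as [hr' |]; [| lra].
pose proof (phi_pos r hr) as hp.
assert (hpc : forall x, continuous (fun t => c * pot t) x)
  by (pose proof pot_continuous; intros x; cont).
assert (hq : quot (fun t => c * pot t) r <= c / phi r - c / phi rho).
{ apply Rle_trans with (RInt (fun s => c * (logd s / phi s)) r rho).
  - assert (hex : ex_RInt (fun s => c * (logd s / phi s)) r rho).
    { apply (ex_RInt_continuous (V := R_CompleteNormedModule)).
      rewrite Rmin_left, Rmax_right by lra; intros s hs.
      apply (ex_derive_continuous (fun s => c * (logd s / phi s))).
      unfold phi, logd; auto_derive; split; [lra | split; [| trivial]].
      pose proof (phi_pos s ltac:(lra)); unfold phi in *.
      simpl in *; lra. }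
    apply RInt_le; [lra | apply quot_ex_RInt; lra || assumption | exact hex |].
    intros s hs; pose proof (phi_pos s ltac:(lra)) as hps.
    replace (flux (fun t => c * pot t) s) with (c * flux pot s).
    2:{ unfold flux; rewrite <- RInt_Rscal.
        - apply RInt_Rext; intros; ring.
        - apply ex_RInt_cont; intros x; apply flux_integrand_continuous, pot_continuous. }
    unfold Rdiv; rewrite (Rmult_assoc c); apply Rmult_le_compat_l; [exact hc |].
    apply Rle_div_l; [apply Rmult_lt_0_compat; [lra | apply pow_lt; lra] |].
    replace (logd s * / phi s * (s * phi s ^ 2)) with (s * logd s * phi s)
      by (field; lra).
    apply flux_pot_le; lra.
  - right; apply is_RInt_unique.
    replace (c / phi r - c / phi rho) with ((- c / phi rho) - (- c / phi r))
      by (unfold Rdiv; ring).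
    apply (is_RInt_derive (fun s => - c / phi s) (fun s => c * (logd s / phi s))).
    + rewrite Rmin_left, Rmax_right by lra; intros s hs.
      pose proof (phi_pos s ltac:(lra)) as hps.
      replace (c * (logd s / phi s))
        with ((0 * phi s - - c * (logd s * phi s)) / phi s ^ 2) by (field; lra).
      apply (is_derive_div (fun _ => - c) phi);
        [exact (is_derive_const (- c) s) | apply phi_derive; lra | lra].
    + rewrite Rmin_left, Rmax_right by lra; intros s hs.
      apply (ex_derive_continuous (fun s => c * (logd s / phi s))).
      unfold phi, logd; auto_derive; split; [lra | split; [| trivial]].
      pose proof (phi_pos s ltac:(lra)); unfold phi in *.
      simpl in *; lra. }
apply Rle_trans with (phi r * (c / phi r)); [| right; field; lra].
apply Rmult_le_compat_l; [lra |].
assert (0 <= c / phi rho)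
  by (apply Rmult_le_pos; [lra | left; apply Rinv_0_lt_compat, phi_pos; exact hrho]).
lra.
Qed.

(** Once [flux b] is positive it stays so up to [rho], and [green b r] integrates it
    over [[r, rho]]. *)
Lemma green_pos (b : R -> R) (r r0 : R) :
  (forall x, continuous b x) -> (forall t, 0 <= t <= rho -> 0 <= b t) ->
  0 < r0 < rho -> 0 < b r0 -> 0 < r < rho -> 0 < green b r.
Proof.
intros hb hpos hr0 hb0 hr.
assert (hflux : forall s, r0 < s <= rho -> 0 < flux b s).
{ intros s hs.
  destruct (proj1 (filterlim_locally b (b r0)) (hb r0) (mkposreal (b r0) hb0))
    as [e he].
  pose proof (cond_pos e) as hepos.
  set (d := Rmin (r0 + e / 2) s).
  assert (hd0 : r0 < d) by (apply Rmin_glb_lt; lra).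
  assert (hd1 : d <= r0 + e / 2) by apply Rmin_l.
  assert (hd2 : d <= s) by apply Rmin_r.
  assert (hbd : forall t, r0 <= t <= d -> 0 < b t).
  { intros t ht; assert (hball : ball r0 e t).
    { change (Rabs (t - r0) < e); apply Rabs_def1; lra. }
    specialize (he t hball); change (Rabs (b t - b r0) < b r0) in he.
    apply Rabs_def2 in he; lra. }
  assert (hex : forall x y, ex_RInt (fun t => t * phi t * b t) x y)
    by (intros; apply ex_RInt_cont; intros z; apply flux_integrand_continuous, hb).
  assert (hnn : forall x y, 0 <= x <= y -> y <= rho ->
    0 <= RInt (fun t => t * phi t * b t) x y).
  { intros x y hx hy; apply RInt_ge_0; [lra | apply hex |].
    intros t ht; apply Rmult_le_pos; [| apply hpos; lra].
    apply Rmult_le_pos; [lra | apply phi_nonneg; lra]. }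
  unfold flux.
  rewrite (RInt_RChasles _ 0 r0 s), (RInt_RChasles _ r0 d s) by apply hex.
  pose proof (hnn 0 r0 ltac:(lra) ltac:(lra)).
  pose proof (hnn d s ltac:(lra) ltac:(lra)).
  assert (0 < RInt (fun t => t * phi t * b t) r0 d).
  { apply RInt_gt_0; [lra | |].
    - intros t ht; apply Rmult_lt_0_compat; [| apply hbd; lra].
      apply Rmult_lt_0_compat; [lra | apply phi_pos; lra].
    - intros t ht; apply flux_integrand_continuous, hb. }
  lra. }
rewrite green_inside by lra.
apply Rmult_lt_0_compat; [apply phi_pos; lra |].
set (d := Rmax r r0).
assert (hd0 : r <= d) by apply Rmax_l.
assert (hd1 : r0 <= d) by apply Rmax_r.
assert (hd2 : d < rho) by (apply Rmax_lub_lt; lra).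
unfold quot.
rewrite (RInt_RChasles _ r d rho) by (apply quot_ex_RInt; lra || assumption).
assert (0 <= RInt (fun s => flux b s / (s * phi s ^ 2)) r d).
{ apply RInt_ge_0; [lra | apply quot_ex_RInt; lra || assumption |].
  intros s hs; apply quot_integrand_nonneg; try assumption; lra. }
assert (0 < RInt (fun s => flux b s / (s * phi s ^ 2)) d rho).
{ apply RInt_gt_0; [lra | |].
  - intros s hs; apply Rdiv_lt_0_compat; [apply hflux; lra |].
    apply Rmult_lt_0_compat; [lra | apply pow_lt, phi_pos; lra].
  - intros s hs; apply quot_integrand_continuous; [exact hb | lra]. }
lra.
Qed.

(** Differentiating [A' = logd * A - flux b / (r * phi)] once more, the terms in
    [flux b] combine into [- A' / r], and
    [logd' + logd / r + logd ^ 2 = n ^ 2 / r ^ 2 + pot]. *)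
Lemma green_solves (b : R -> R) (r : R) :
  (forall x, continuous b x) -> 0 < r < rho ->
  ex_derive (green b) r /\ ex_derive (Derive (green b)) r /\
  Derive_n (green b) 2 r + 1 / r * Derive (green b) r
    - INR n ^ 2 / r ^ 2 * green b r - pot r * green b r + b r = 0.
Proof.
intros hb hr; pose proof (phi_pos r (proj1 hr)) as hp.
pose proof (green_derive b r hb hr) as h1.
set (v := fun x => flux b x / (x * phi x)).
assert (hd : Derive (green b) r = logd r * green b r - v r)
  by (apply is_derive_unique; exact h1).
assert (hv : is_derive v r (b r - v r * (1 / r + logd r))).
{ replace (b r - v r * (1 / r + logd r)) with
    ((r * phi r * b r * (r * phi r)
      - flux b r * (1 * phi r + r * (logd r * phi r))) / (r * phi r) ^ 2)
    by (unfold v; field; lra).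
  apply (is_derive_div (flux b) (fun x => x * phi x)).
  - apply flux_derive, hb.
  - apply (is_derive_mult (fun x => x) phi);
      [exact (is_derive_id r) | apply phi_derive; lra | exact Rmult_comm].
  - apply Rmult_integral_contrapositive_currified; lra. }
assert (h2 : is_derive (Derive (green b)) r
  ((- INR n / r ^ 2 + 2 * kap) * green b r + logd r * (logd r * green b r - v r)
    - (b r - v r * (1 / r + logd r)))).
{ apply (is_derive_ext_loc (fun x => logd x * green b x - v x)).
  - apply (locally_interval _ r 0 rho); simpl; try lra.
    intros y hy0 hy1; simpl in *; symmetry; apply is_derive_unique.
    apply green_derive; [exact hb | lra].
  - apply (is_derive_minus (fun x => logd x * green b x) v); [| exact hv].
    apply (is_derive_mult logd (green b)); [| exact h1 | exact Rmult_comm].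
    unfold logd; auto_derive; [lra | field; lra]. }
split; [eexists; exact h1 | split; [eexists; exact h2 |]].
change (Derive_n (green b) 2 r) with (Derive (Derive (green b)) r).
rewrite (is_derive_unique _ _ _ h2), hd.
unfold logd, pot; field; lra.
Qed.


Lemma green_plus (b1 b2 : R -> R) (r : R) :
  (forall x, continuous b1 x) -> (forall x, continuous b2 x) ->
  green (fun t => b1 t + b2 t) r = green b1 r + green b2 r.
Proof.
intros h1 h2; unfold green.
destruct (Rlt_dec 0 r) as [hr |]; [| ring].
destruct (Rlt_dec r rho) as [hr' |]; [| ring].
rewrite <- Rmult_plus_distr_l; f_equal; unfold quot.
rewrite <- RInt_Rplus by (apply quot_ex_RInt; assumption).
apply RInt_Rext; intros s _; unfold flux.
rewrite (RInt_Rext _ (fun t => t * phi t * b1 t + t * phi t * b2 t))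
  by (intros; ring).
rewrite RInt_Rplus
  by (apply ex_RInt_cont; intros x; apply flux_integrand_continuous; assumption).
unfold Rdiv; ring.
Qed.

Definition admissible (b : R -> R) (B : R) : Prop :=
  (forall x, continuous b x) /\ (forall t, 0 <= t <= rho -> 0 <= b t <= B).

(** Let [A = phi * z] and let [Y] be a running energy with
    [Y' >= r * phi ^ 2 * z' ^ 2 / 2]. Along [r], the energy of [A], minus the pairing
    of [b] with [A], plus half the energy of [green b], can be corrected by the
    boundary terms [flux b * z] and [flux b * quot b / 2] so that its derivative is
    at least the square
    [r * phi ^ 2 / 2 * (z' + flux b / (r * phi ^ 2)) ^ 2].
    Here [C] is a continuous function on the line that extends [A], so that the
    integral may start at [0] although [A] is smooth on a subinterval only. *)
Definition young_gap (b C A Y : R -> R) (r : R) : R :=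
  Y r - RInt (fun s => s * b s * C s) 0 r + flux b r * A r / phi r
  + / 2 * RInt (fun s => s * b s * green b s) 0 r - / 2 * (flux b r * quot b r).

Lemma young_gap_le (b C A dA Y dY : R -> R) (B a c : R) :
  admissible b B -> (forall x, continuous C x) ->
  0 < a <= c -> c <= rho ->
  (forall x, a <= x <= c -> A x = C x) ->
  (forall x, a <= x <= c -> is_derive A x (dA x)) ->
  (forall x, a <= x <= c -> is_derive Y x (dY x)) ->
  (forall x, a <= x <= c -> / 2 * (x * (dA x - logd x * A x) ^ 2) <= dY x) ->
  young_gap b C A Y a <= young_gap b C A Y c.
Proof.
intros [hb hB] hC hac hc hAC hdA hdY hle.
assert (hg : forall x, continuous (green b) x)
  by (intros x; apply green_continuous with B; assumption).
apply nondecreasing_of_derive with (fun x =>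
  dY x - x * b x * C x
  + (x * phi x * b x * (A x / phi x)
     + flux b x * ((dA x * phi x - A x * (logd x * phi x)) / phi x ^ 2))
  + / 2 * (x * b x * green b x)
  - / 2 * (x * phi x * b x * quot b x
     + flux b x * - (flux b x / (x * phi x ^ 2)))); [lra | |].
- intros x hx; pose proof (phi_pos x ltac:(lra)) as hp; unfold young_gap.
  apply (is_derive_minus (fun r => Y r - RInt (fun s => s * b s * C s) 0 r
    + flux b r * A r / phi r + / 2 * RInt (fun s => s * b s * green b s) 0 r)
    (fun r => / 2 * (flux b r * quot b r))).
  2:{ apply (is_derive_scal (fun r => flux b r * quot b r) x (/ 2)).
      apply (is_derive_mult (flux b) (quot b)); [apply flux_derive, hb | | exact Rmult_comm].
      apply quot_derive; [exact hb | lra]. }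
  apply (is_derive_plus (fun r => Y r - RInt (fun s => s * b s * C s) 0 r
    + flux b r * A r / phi r) (fun r => / 2 * RInt (fun s => s * b s * green b s) 0 r)).
  2:{ apply (is_derive_scal (fun r => RInt (fun s => s * b s * green b s) 0 r) x (/ 2)).
      apply (is_derive_RInt_cont (fun s => s * b s * green b s)); intros y; cont. }
  apply (is_derive_plus (fun r => Y r - RInt (fun s => s * b s * C s) 0 r)
    (fun r => flux b r * A r / phi r)).
  + apply (is_derive_minus Y (fun r => RInt (fun s => s * b s * C s) 0 r));
      [apply hdY, hx |].
    apply (is_derive_RInt_cont (fun s => s * b s * C s)); intros y; cont.
  + apply (is_derive_ext (fun r => flux b r * (A r / phi r)));
      [intros t; unfold Rdiv; symmetry; apply Rmult_assoc |].
    apply (is_derive_mult (flux b) (fun r => A r / phi r));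
      [apply flux_derive, hb | | exact Rmult_comm].
    apply (is_derive_div A phi); [apply hdA, hx | apply phi_derive; lra | lra].
- intros x hx; pose proof (phi_pos x ltac:(lra)) as hp.
  rewrite green_inside, <- hAC by lra.
  specialize (hle x hx).
  (* [phi * z' = dA - logd * A]; the expression below is the completed square. *)
  apply Rle_trans with
    (/ 2 * (x * (dA x - logd x * A x + flux b x / (x * phi x)) ^ 2)).
  + apply Rmult_le_pos; [lra | apply Rmult_le_pos; [lra | apply pow2_ge_0]].
  + apply Rminus_le.
    match goal with |- ?l <= 0 =>
      replace l with (/ 2 * (x * (dA x - logd x * A x) ^ 2) - dY x) by (field; lra)
    end; lra.
Qed.

Lemma flux_quot_le (b : R -> R) (B a : R) :
  admissible b B -> 0 < a <= rho -> 0 <= flux b a * quot b a <= B ^ 2 * rho * a ^ 3.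
Proof.
intros [hb hB] ha.
assert (hpos : forall t, 0 <= t <= rho -> 0 <= b t) by (intros; apply hB; assumption).
assert (hB0 : 0 <= B) by (specialize (hB a ltac:(lra)); lra).
pose proof (phi_pos a (proj1 ha)) as hp.
pose proof (flux_nonneg b a hb hpos ltac:(lra)) as hf0.
pose proof (flux_bound b B a hb hB ltac:(lra)) as hf1.
pose proof (green_nonneg b a hb hpos) as hg0.
pose proof (green_bound b B a hb hB ltac:(lra)) as hg1.
replace (flux b a * quot b a) with (flux b a / phi a * green b a)
  by (rewrite green_inside by lra; field; lra).
assert (hq0 : 0 <= flux b a / phi a)
  by (apply Rmult_le_pos; [lra | left; apply Rinv_0_lt_compat; lra]).
assert (hq1 : flux b a / phi a <= B * a ^ 2) by (apply Rle_div_l; lra).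
split; [apply Rmult_le_pos; assumption |].
apply Rle_trans with (B * a ^ 2 * (B * a * rho)); [| right; ring].
apply Rmult_le_compat; try assumption.
apply Rle_trans with (1 := hg1), Rmult_le_compat_l; [apply Rmult_le_pos |]; lra.
Qed.

Lemma young_gap_near_0 (b C A Y : R -> R) (B a : R) :
  admissible b B -> 0 < a <= rho -> 0 <= A a ->
  Y a - RInt (fun s => s * b s * C s) 0 a - / 2 * (B ^ 2 * rho * a ^ 3)
    <= young_gap b C A Y a.
Proof.
intros hb ha hA; pose proof (flux_quot_le b B a hb ha) as hfq.
destruct hb as [hb hB].
assert (hpos : forall t, 0 <= t <= rho -> 0 <= b t) by (intros; apply hB; assumption).
assert (hi : 0 <= RInt (fun s => s * b s * green b s) 0 a).
{ apply RInt_ge_0; [lra | |].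
  - apply ex_RInt_cont; intros x.
    assert (forall x, continuous (green b) x)
      by (intros y; apply green_continuous with B; assumption).
    cont.
  - intros s hs; apply Rmult_le_pos; [| apply green_nonneg; assumption].
    apply Rmult_le_pos; [lra | apply hpos; lra]. }
assert (0 <= flux b a * A a / phi a).
{ apply Rmult_le_pos; [| left; apply Rinv_0_lt_compat, phi_pos; lra].
  apply Rmult_le_pos; [apply flux_nonneg; try assumption; lra | exact hA]. }
unfold young_gap; lra.
Qed.

Lemma RInt_0_continuous (f : R -> R) (x : R) :
  (forall x, continuous f x) -> continuous (fun y => RInt f 0 y) x.
Proof.
intros hf; apply (ex_derive_continuous (fun y => RInt f 0 y)).
exists (f x); apply is_derive_RInt_cont, hf.
Qed.

Lemma RInt_0_0 (f : R -> R) : RInt f 0 0 = 0.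
Proof. exact (RInt_point (V := R_CompleteNormedModule) 0 f). Qed.

(** Expanding [<b1 - b2, green (b1 - b2)> >= 0], for the pairing of weight [s],
    gives this inequality as [green] is symmetric. Here it is [young_gap] for
    [A = green b1], whose running energy is [b1 * A] up to a boundary term. *)
Lemma green_young (b1 b2 : R -> R) (B1 B2 : R) :
  admissible b1 B1 -> admissible b2 B2 ->
  RInt (fun s => s * b2 s * green b1 s) 0 rho <=
    / 2 * RInt (fun s => s * b1 s * green b1 s) 0 rho
    + / 2 * RInt (fun s => s * b2 s * green b2 s) 0 rho.
Proof.
intros hb1 hb2.
assert (hg1 : forall x, continuous (green b1) x)
  by (intros x; apply green_continuous with B1; apply hb1).
assert (hc1 : forall x, continuous (fun s => s * b1 s * green b1 s) x)
  by (pose proof (proj1 hb1); intros x; cont).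
assert (hc2 : forall x, continuous (fun s => s * b2 s * green b1 s) x)
  by (pose proof (proj1 hb2); intros x; cont).
set (A := fun r => phi r * quot b1 r).
set (Y := fun r => / 2 * RInt (fun s => s * b1 s * green b1 s) 0 r
  - / 2 * (flux b1 r * quot b1 r)).
set (J := fun a => - (/ 2 * (B1 ^ 2 * rho * a ^ 3))
  - RInt (fun s => s * b2 s * green b1 s) 0 a - / 2 * (B2 ^ 2 * rho * a ^ 3)).
assert (hJ0 : J 0 = 0) by (unfold J; rewrite RInt_0_0; ring).
assert (hJc : continuous J 0).
{ assert (continuous (fun a => - (/ 2 * (B1 ^ 2 * rho * a ^ 3))) 0)
    by (apply (ex_derive_continuous (fun a => - (/ 2 * (B1 ^ 2 * rho * a ^ 3))));
        auto_derive; trivial).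
  assert (continuous (fun a => / 2 * (B2 ^ 2 * rho * a ^ 3)) 0)
    by (apply (ex_derive_continuous (fun a => / 2 * (B2 ^ 2 * rho * a ^ 3)));
        auto_derive; trivial).
  pose proof (RInt_0_continuous (fun s => s * b2 s * green b1 s) 0 hc2).
  unfold J; cont. }
assert (hend : young_gap b2 (green b1) A Y rho =
  / 2 * RInt (fun s => s * b1 s * green b1 s) 0 rho
  - RInt (fun s => s * b2 s * green b1 s) 0 rho
  + / 2 * RInt (fun s => s * b2 s * green b2 s) 0 rho).
{ unfold young_gap, Y, A; rewrite !quot_rho.
  pose proof (phi_pos rho hrho); field; lra. }
enough (0 <= young_gap b2 (green b1) A Y rho) by lra.
rewrite <- hJ0; apply le_at_0_of_le_right with rho; [exact hrho | exact hJc |].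
intros a ha.
apply Rle_trans with (young_gap b2 (green b1) A Y a).
- assert (hA : 0 <= A a).
  { unfold A; rewrite <- green_inside by lra; apply green_nonneg; [apply hb1 |].
    intros t ht; apply hb1, ht. }
  pose proof (young_gap_near_0 b2 (green b1) A Y B2 a hb2 ltac:(lra) hA) as h.
  pose proof (flux_quot_le b1 B1 a hb1 ltac:(lra)).
  assert (0 <= RInt (fun s => s * b1 s * green b1 s) 0 a).
  { apply RInt_ge_0; [lra | apply ex_RInt_cont, hc1 |].
    destruct hb1 as [hb1 hB1].
    intros s hs; apply Rmult_le_pos.
    - apply Rmult_le_pos; [lra | apply hB1; lra].
    - apply green_nonneg; [exact hb1 | intros t ht; apply hB1, ht]. }
  unfold Y in h at 1; unfold J; lra.
- apply young_gap_le with
    (dA := fun r => logd r * phi r * quot b1 r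
      + phi r * - (flux b1 r / (r * phi r ^ 2)))
    (dY := fun r => / 2 * (r * b1 r * green b1 r)
      - / 2 * (r * phi r * b1 r * quot b1 r
        + flux b1 r * - (flux b1 r / (r * phi r ^ 2))))
    (B := B2); try assumption; try lra.
  + intros x hx; unfold A; rewrite green_inside by lra; reflexivity.
  + intros x hx; unfold A.
    apply (is_derive_mult phi (quot b1)); [apply phi_derive; lra | | exact Rmult_comm].
    apply quot_derive; [apply hb1 | lra].
  + intros x hx; unfold Y.
    apply (is_derive_minus (fun r => / 2 * RInt (fun s => s * b1 s * green b1 s) 0 r)
      (fun r => / 2 * (flux b1 r * quot b1 r))).
    * apply (is_derive_scal (fun r => RInt (fun s => s * b1 s * green b1 s) 0 r) x (/ 2)).
      apply (is_derive_RInt_cont (fun s => s * b1 s * green b1 s)), hc1.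
    * apply (is_derive_scal (fun r => flux b1 r * quot b1 r) x (/ 2)).
      apply (is_derive_mult (flux b1) (quot b1));
        [apply flux_derive, hb1 | apply quot_derive; [apply hb1 | lra] | exact Rmult_comm].
  + intros x hx; pose proof (phi_pos x ltac:(lra)) as hp.
    rewrite green_inside by lra; right; unfold A; field; lra.
Qed.

Definition tent (h r : R) : R := h - 2 * h / rho * Rabs (r - rho / 2).

Lemma tent_continuous (h x : R) : continuous (tent h) x.
Proof.
assert (forall y, continuous (fun r => Rabs (r - rho / 2)) y).
{ intros y; apply (continuous_comp (fun r => r - rho / 2) Rabs); [cont |].
  apply continuous_Rabs. }
unfold tent; cont.
Qed.

Lemma tent_left (h r : R) : r <= rho / 2 -> tent h r = 2 * h / rho * r.
Proof.
intros hr; unfold tent; rewrite Rabs_left1 by lra; field; lra.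
Qed.

Lemma tent_right (h r : R) : rho / 2 <= r -> tent h r = 2 * h / rho * (rho - r).
Proof.
intros hr; unfold tent; rewrite Rabs_pos_eq by lra; field; lra.
Qed.

Lemma tent_bounds (h r : R) : 0 <= h -> 0 <= r <= rho -> 0 <= tent h r <= h.
Proof.
intros hh hr.
assert (hc : 0 <= 2 * h / rho)
  by (apply Rmult_le_pos; [lra | left; apply Rinv_0_lt_compat; lra]).
assert (he : h = 2 * h / rho * (rho / 2)) by (field; lra).
destruct (Rle_or_lt r (rho / 2)).
- rewrite tent_left by lra; split; [apply Rmult_le_pos; lra |].
  rewrite he at 2; apply Rmult_le_compat_l; lra.
- rewrite tent_right by lra; split; [apply Rmult_le_pos; lra |].
  rewrite he at 2; apply Rmult_le_compat_l; lra.
Qed.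

(** The energy of the tent without the potential is
    [2 * h ^ 2 * (1 + n ^ 2 * (2 * ln 2 - 1))], and its running value has a closed
    form on each half of the interval. In [Y1] and [Y2] below, [E] is the
    contribution of the potential, and the boundary term [r * logd r * A r ^ 2 / 2]
    is subtracted. *)
Lemma tent_young (h B : R) (b : R -> R) :
  0 <= h -> admissible b B ->
  RInt (fun s => s * b s * tent h s) 0 rho <=
    h ^ 2 * (1 + INR n ^ 2 * (2 * ln 2 - 1))
    + / 2 * RInt (fun s => s * pot s * tent h s ^ 2) 0 rho
    + / 2 * RInt (fun s => s * b s * green b s) 0 rho.
Proof.
intros hh hb; pose proof (tent_continuous h) as ht.
set (c := 2 * h / rho).
assert (hcrho : c * rho = 2 * h) by (unfold c; field; lra).
pose proof pot_continuous as hpc.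
assert (hE : forall x, continuous (fun s => s * pot s * tent h s ^ 2) x).
{ intros x; cont. }
assert (hbt : forall x, continuous (fun s => s * b s * tent h s) x)
  by (pose proof (proj1 hb); intros x; cont).
set (E := fun r => / 2 * RInt (fun s => s * pot s * tent h s ^ 2) 0 r).
assert (hEd : forall r, is_derive E r (/ 2 * (r * pot r * tent h r ^ 2))).
{ intros r.
  apply (is_derive_scal (fun r => RInt (fun s => s * pot s * tent h s ^ 2) 0 r) r (/ 2)).
  apply (is_derive_RInt_cont (fun s => s * pot s * tent h s ^ 2)), hE. }
assert (hEc : continuous E 0)
  by (apply (ex_derive_continuous E); eexists; apply hEd).
set (A1 := fun r => c * r).
set (A2 := fun r => c * (rho - r)).
set (Y1 := fun r => E r + (c ^ 2 * (1 + INR n ^ 2) * r ^ 2 / 4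
  - / 2 * (INR n + 2 * kap * r ^ 2) * (c * r) ^ 2)).
set (Y2 := fun r => E r + (c ^ 2 * r ^ 2 / 4
  + / 2 * INR n ^ 2 * c ^ 2 * (rho ^ 2 * ln r - 2 * rho * r + r ^ 2 / 2)
  - / 2 * (INR n + 2 * kap * r ^ 2) * (c * (rho - r)) ^ 2)).
set (J := fun a => Y1 a - RInt (fun s => s * b s * tent h s) 0 a
  - / 2 * (B ^ 2 * rho * a ^ 3)).
assert (hJ0 : J 0 = 0) by (unfold J, Y1, E; rewrite !RInt_0_0; field).
assert (hJc : continuous J 0).
{ assert (continuous (fun r => c ^ 2 * (1 + INR n ^ 2) * r ^ 2 / 4
    - / 2 * (INR n + 2 * kap * r ^ 2) * (c * r) ^ 2) 0)
    by (apply (ex_derive_continuous (fun r => c ^ 2 * (1 + INR n ^ 2) * r ^ 2 / 4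
         - / 2 * (INR n + 2 * kap * r ^ 2) * (c * r) ^ 2)); auto_derive; trivial).
  assert (continuous (fun a => / 2 * (B ^ 2 * rho * a ^ 3)) 0)
    by (apply (ex_derive_continuous (fun a => / 2 * (B ^ 2 * rho * a ^ 3)));
        auto_derive; trivial).
  pose proof (RInt_0_continuous (fun s => s * b s * tent h s) 0 hbt).
  unfold J, Y1; cont. }
assert (h2 : young_gap b (tent h) A2 Y2 (rho / 2) <= young_gap b (tent h) A2 Y2 rho).
{ apply young_gap_le with (B := B) (dA := fun _ => - c)
    (dY := fun r => / 2 * (r * pot r * tent h r ^ 2) + (c ^ 2 * r / 2
      + / 2 * INR n ^ 2 * c ^ 2 * (rho ^ 2 / r - 2 * rho + r)
      - (2 * kap * r * (c * (rho - r)) ^ 2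
         - (INR n + 2 * kap * r ^ 2) * (c * (rho - r)) * c)));
    try assumption; try lra.
  - intros x hx; rewrite tent_right by lra; reflexivity.
  - intros x hx; unfold A2; auto_derive; [trivial | ring].
  - intros x hx; unfold Y2.
    apply (is_derive_plus E (fun r => c ^ 2 * r ^ 2 / 4
      + / 2 * INR n ^ 2 * c ^ 2 * (rho ^ 2 * ln r - 2 * rho * r + r ^ 2 / 2)
      - / 2 * (INR n + 2 * kap * r ^ 2) * (c * (rho - r)) ^ 2)); [apply hEd |].
    auto_derive; [lra | field; lra].
  - intros x hx; rewrite tent_right by lra; fold c.
    right; unfold A2, logd, pot; field; lra. }
(* The gaps of the two halves agree at the apex except for their energies. *)
assert (hmid : young_gap b (tent h) A1 Y1 (rho / 2) - Y1 (rho / 2)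
  = young_gap b (tent h) A2 Y2 (rho / 2) - Y2 (rho / 2)).
{ unfold young_gap; replace (A2 (rho / 2)) with (A1 (rho / 2))
    by (unfold A1, A2; field); ring. }
assert (hY : Y2 rho - Y2 (rho / 2) + Y1 (rho / 2)
  = h ^ 2 * (1 + INR n ^ 2 * (2 * ln 2 - 1)) + E rho).
{ unfold Y1, Y2; rewrite ln_div by lra.
  replace h with (c * rho / 2) by lra; field. }
assert (hend : young_gap b (tent h) A2 Y2 rho
  = Y2 rho - RInt (fun s => s * b s * tent h s) 0 rho
    + / 2 * RInt (fun s => s * b s * green b s) 0 rho).
{ unfold young_gap, A2; rewrite quot_rho.
  pose proof (phi_pos rho hrho); field; lra. }
enough (0 <= young_gap b (tent h) A1 Y1 (rho / 2)) by (unfold E in hY; lra).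
rewrite <- hJ0; apply le_at_0_of_le_right with (rho / 2); [lra | exact hJc |].
intros a ha.
apply Rle_trans with (young_gap b (tent h) A1 Y1 a).
- apply (young_gap_near_0 b (tent h) A1 Y1 B a hb); [lra |].
  unfold A1, c; apply Rmult_le_pos; [| lra].
  apply Rmult_le_pos; [lra | left; apply Rinv_0_lt_compat; lra].
- apply young_gap_le with (B := B) (dA := fun _ => c)
    (dY := fun r => / 2 * (r * pot r * tent h r ^ 2)
      + (c ^ 2 * (1 + INR n ^ 2) * r / 2
         - (2 * kap * r * (c * r) ^ 2 + (INR n + 2 * kap * r ^ 2) * (c * r) * c)));
    try assumption; try lra.
  + intros x hx; rewrite tent_left by lra; reflexivity.
  + intros x hx; unfold A1; auto_derive; [trivial | ring].
  + intros x hx; unfold Y1.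
    apply (is_derive_plus E (fun r => c ^ 2 * (1 + INR n ^ 2) * r ^ 2 / 4
      - / 2 * (INR n + 2 * kap * r ^ 2) * (c * r) ^ 2)); [apply hEd |].
    auto_derive; [trivial | field].
  + intros x hx; rewrite tent_left by lra; fold c.
    right; unfold A1, logd, pot; field; lra.
Qed.

End Inverse.
(** * The nonlinearity *)

Definition sat (a : R) : R := a ^ 3 / (1 + a ^ 2) ^ 2.

Definition satF (a : R) : R := / 2 * (ln (1 + a ^ 2) - a ^ 2 / (1 + a ^ 2)).

Lemma sat_derive (a : R) :
  is_derive sat a (a ^ 2 * (3 - a ^ 2) / (1 + a ^ 2) ^ 3).
Proof.
pose proof (pow2_ge_0 a) as ha; unfold sat; auto_derive.
- simpl; nra.
- field; nra.
Qed.

Lemma satF_derive (a : R) : is_derive satF a (sat a).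
Proof.
pose proof (pow2_ge_0 a) as ha; unfold satF, sat; auto_derive.
- simpl in *; repeat split; lra.
- field; nra.
Qed.

Lemma sat_derive_bound (a : R) :
  -1 <= a ^ 2 * (3 - a ^ 2) / (1 + a ^ 2) ^ 3 <= 1.
Proof.
pose proof (pow2_ge_0 a) as ha; set (x := a ^ 2) in *.
assert (0 < (1 + x) ^ 3) by (apply pow_lt; lra).
assert (0 <= x ^ 2) by apply pow2_ge_0.
assert (0 <= x ^ 3) by (apply pow_le; exact ha).
split; [apply Rle_div_r | apply Rle_div_l]; try assumption; nra.
Qed.

Lemma sat_plus_incr (x y : R) : x <= y -> sat x + x <= sat y + y.
Proof.
intros hxy; apply (nondecreasing_of_derive (fun a => sat a + a)
  (fun a => a ^ 2 * (3 - a ^ 2) / (1 + a ^ 2) ^ 3 + 1)); [exact hxy | |].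
- intros a _; apply (is_derive_plus sat (fun a => a));
    [apply sat_derive | exact (is_derive_id a)].
- intros a _; pose proof (sat_derive_bound a); lra.
Qed.

Lemma sat_minus_decr (x y : R) : x <= y -> sat y - y <= sat x - x.
Proof.
intros hxy; cut (x - sat x <= y - sat y); [lra |].
apply (nondecreasing_of_derive (fun a => a - sat a)
  (fun a => 1 - a ^ 2 * (3 - a ^ 2) / (1 + a ^ 2) ^ 3)); [exact hxy | |].
- intros a _; apply (is_derive_minus (fun a => a) sat);
    [exact (is_derive_id a) | apply sat_derive].
- intros a _; pose proof (sat_derive_bound a); lra.
Qed.

Lemma sat_0 : sat 0 = 0.
Proof. unfold sat; field. Qed.

Lemma satF_0 : satF 0 = 0.
Proof. unfold satF; replace (1 + 0 ^ 2) with 1 by ring; rewrite ln_1; field. Qed.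

Lemma sat_le_linear (c s : R) : 0 <= s -> 1 <= c * (1 + s ^ 2) -> sat s <= c * s.
Proof.
intros hs hc; unfold sat; pose proof (pow2_ge_0 s).
apply Rle_div_l; [apply pow_lt; lra |].
replace (c * s * (1 + s ^ 2) ^ 2) with (c * (1 + s ^ 2) * (s * (1 + s ^ 2))) by ring.
apply Rle_trans with (1 * (s * (1 + s ^ 2))).
- simpl in *; nra.
- apply Rmult_le_compat_r; [apply Rmult_le_pos; lra | exact hc].
Qed.

Section Nonlinear.

Variables (n : nat) (lam rho : R).
Hypotheses (hn : (1 <= n)%nat) (hlam : 0 < lam) (hrho : 0 < rho).

(** The strength [lam + 1] of the potential gives [pot - lam >= 1], and the
    derivative of [sat] is at least [-1], so [react r] is increasing. *)
Definition react (r a : R) : R := sat a + (pot n (lam + 1) r - lam) * a.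

Definition prim (r a : R) : R := satF a + / 2 * ((pot n (lam + 1) r - lam) * a ^ 2).

Definition step (A : R -> R) : R -> R :=
  green n (lam + 1) rho (fun r => react r (A r)).

(** With [b = react r (A r)], convexity of [prim r] makes [b * A - prim A] the
    Legendre transform of [prim r] at [b]. Thus [dual A] is the Toland dual of the
    action, evaluated at [b]. *)
Definition dual (A : R -> R) : R :=
  RInt (fun r => r * (react r (A r) * A r - prim r (A r)
    - / 2 * (react r (A r) * step A r))) 0 rho.

Definition react_lip : R := 1 + pot n (lam + 1) rho.

Let hkap : 0 <= lam + 1.
Proof. lra. Qed.

Lemma pot_ge (r : R) : lam + 1 <= pot n (lam + 1) r.
Proof.
unfold pot; pose proof (INR_n_ge_1 n hn).
assert (0 <= (lam + 1) ^ 2 * r ^ 2)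
  by (apply Rmult_le_pos; apply pow2_ge_0).
nra.
Qed.

Lemma pot_le (r : R) : 0 <= r <= rho -> pot n (lam + 1) r <= pot n (lam + 1) rho.
Proof.
intros hr; unfold pot; apply Rplus_le_compat_l, Rmult_le_compat_l.
- pose proof (pow2_ge_0 (lam + 1)); lra.
- apply pow_incr; lra.
Qed.

Lemma react_lip_pos : 0 < react_lip.
Proof. unfold react_lip; pose proof (pot_ge rho); lra. Qed.

Lemma react_0 (r : R) : react r 0 = 0.
Proof. unfold react; rewrite sat_0; ring. Qed.

Lemma react_incr (r x y : R) : x <= y -> react r x <= react r y.
Proof.
intros hxy; unfold react; pose proof (sat_plus_incr x y hxy).
pose proof (pot_ge r).
assert (0 <= (pot n (lam + 1) r - lam - 1) * (y - x)) by (apply Rmult_le_pos; lra).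
lra.
Qed.

Lemma react_le_lip (r x y : R) :
  0 <= r <= rho -> x <= y -> react r y <= react r x + react_lip * (y - x).
Proof.
intros hr hxy; unfold react, react_lip; pose proof (sat_minus_decr x y hxy).
assert ((pot n (lam + 1) r - lam) * (y - x) <= pot n (lam + 1) rho * (y - x))
  by (apply Rmult_le_compat_r; [lra | pose proof (pot_le r hr); lra]).
lra.
Qed.

Lemma react_bounds (r x s : R) :
  0 <= r <= rho -> 0 <= x <= s -> 0 <= react r x <= react_lip * s.
Proof.
intros hr hx; split.
- rewrite <- (react_0 r); apply react_incr; lra.
- apply Rle_trans with (react r s); [apply react_incr; lra |].
  pose proof (react_le_lip r 0 s hr ltac:(lra)) as h; rewrite react_0 in h; lra.
Qed.

Lemma prim_derive (r a : R) : is_derive (prim r) a (react r a).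
Proof.
apply (is_derive_plus satF (fun a => / 2 * ((pot n (lam + 1) r - lam) * a ^ 2)));
  [apply satF_derive |].
generalize (pot n (lam + 1) r - lam); intros q; auto_derive; [trivial | field].
Qed.

(** [prim r] lies above its tangents because its derivative [react r] is
    nondecreasing. *)
Lemma prim_convex (r x y : R) : prim r x + react r x * (y - x) <= prim r y.
Proof.
assert (hd : forall a, is_derive (fun a => prim r a - react r x * a) a
  (react r a - react r x)).
{ intros a; apply (is_derive_minus (prim r) (fun a => react r x * a));
    [apply prim_derive |].
  generalize (react r x); intros q; auto_derive; [trivial | ring]. }
destruct (Rle_or_lt x y) as [hxy | hxy].
- cut (prim r x - react r x * x <= prim r y - react r x * y); [lra |].
  apply (nondecreasing_of_derive _ _ x y hxy (fun a _ => hd a)).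
  intros a ha; pose proof (react_incr r x a); lra.
- cut (- (prim r y - react r x * y) <= - (prim r x - react r x * x)); [lra |].
  apply (nondecreasing_of_derive (fun a => - (prim r a - react r x * a))
    (fun a => - (react r a - react r x)) y x); [lra | |].
  + intros a _; apply (is_derive_opp (fun a => prim r a - react r x * a)), hd.
  + intros a ha; pose proof (react_incr r a x); lra.
Qed.

Lemma prim_0 (r : R) : prim r 0 = 0.
Proof. unfold prim; rewrite satF_0; ring. Qed.

Lemma react_continuous (A : R -> R) (x : R) :
  (forall x, continuous A x) -> continuous (fun r => react r (A r)) x.
Proof.
intros hA.
assert (forall y, continuous (fun r => sat (A r)) y).
{ intros y; apply (continuous_comp A sat); [apply hA |].
  apply (ex_derive_continuous sat); eexists; apply sat_derive. }
pose proof (pot_continuous n (lam + 1)) as hp.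
unfold react; cont.
Qed.

Lemma prim_continuous (A : R -> R) (x : R) :
  (forall x, continuous A x) -> continuous (fun r => prim r (A r)) x.
Proof.
intros hA.
assert (forall y, continuous (fun r => satF (A r)) y).
{ intros y; apply (continuous_comp A satF); [apply hA |].
  apply (ex_derive_continuous satF); eexists; apply satF_derive. }
pose proof (pot_continuous n (lam + 1)) as hp.
unfold prim; cont.
Qed.

Lemma react_admissible (A : R -> R) (s : R) :
  admissible rho A s -> admissible rho (fun r => react r (A r)) (react_lip * s).
Proof.
intros [hA hAs]; split; [intros x; apply react_continuous, hA |].
intros t ht; apply react_bounds; [exact ht | apply hAs, ht].
Qed.

Lemma step_nonneg (A : R -> R) (s r : R) : admissible rho A s -> 0 <= step A r.
Proof.
intros hA; apply react_admissible in hA; destruct hA as [hb hB].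
apply green_nonneg; try assumption; intros t ht; apply hB, ht.
Qed.

Lemma step_lipschitz (A : R -> R) (s x y : R) : admissible rho A s ->
  Rabs (step A x - step A y)
    <= green_lip n (lam + 1) rho (react_lip * s) * Rabs (x - y).
Proof.
intros hA; apply react_admissible in hA; destruct hA as [hb hB].
apply green_lipschitz; assumption.
Qed.

Lemma step_continuous (A : R -> R) (s x : R) :
  admissible rho A s -> continuous (step A) x.
Proof.
intros hA; eapply lipschitz_continuous; intros; eapply step_lipschitz, hA.
Qed.

Lemma step_le (A1 A2 : R -> R) (r : R) :
  (forall x, continuous A1 x) -> (forall x, continuous A2 x) ->
  (forall t, 0 <= t <= rho -> A1 t <= A2 t) -> step A1 r <= step A2 r.
Proof.
intros h1 h2 hle; apply green_le; try assumption.
1, 2: intros x; apply react_continuous; assumption.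
intros t ht; apply react_incr, hle, ht.
Qed.

(** Where saturation makes [sat s <= lam * s], the constant [s] is a
    supersolution. *)
Lemma step_admissible (A : R -> R) (s : R) : 0 <= s -> 1 <= lam * (1 + s ^ 2) ->
  admissible rho A s -> admissible rho (step A) s.
Proof.
intros hs hbig hA; split; [intros x; apply step_continuous with s, hA |].
intros t ht; split; [apply step_nonneg with s, hA |].
apply Rle_trans with (green n (lam + 1) rho (fun t => s * pot n (lam + 1) t) t);
  [| apply green_pot_le; assumption].
pose proof (pot_continuous n (lam + 1)) as hp.
apply green_le; try assumption.
- intros x; apply react_continuous, hA.
- intros x; cont.
- intros x hx; destruct hA as [_ hA].
  apply Rle_trans with (react x s); [apply react_incr, hA, hx |].
  unfold react; pose proof (sat_le_linear lam s hs hbig); lra.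
Qed.

Lemma dual_integrand_continuous (A : R -> R) (s x : R) : admissible rho A s ->
  continuous (fun r => r * (react r (A r) * A r - prim r (A r)
    - / 2 * (react r (A r) * step A r))) x.
Proof.
intros hA.
assert (forall x, continuous (step A) x) by (intros y; apply step_continuous with s, hA).
destruct hA as [hA _].
assert (forall x, continuous (fun r => react r (A r)) x)
  by (intros y; apply react_continuous, hA).
assert (forall x, continuous (fun r => prim r (A r)) x)
  by (intros y; apply prim_continuous, hA).
cont.
Qed.

(** Replacing [A] by [A1 = step A] in the Legendre transform at [b = react r (A r)]
    can only lower it, by convexity; what is left is [green_young] for the sources
    that belong to [A] and to [A1]. *)
Lemma dual_step_le (A : R -> R) (s : R) :
  admissible rho A s -> admissible rho (step A) s -> dual (step A) <= dual A.
Proof.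
intros hA hA1.
pose proof (react_admissible A s hA) as hb.
pose proof (react_admissible (step A) s hA1) as hb1.
assert (hc2 : forall x, continuous (step (step A)) x)
  by (intros x; apply step_continuous with s, hA1).
pose proof (green_young n (lam + 1) rho hn hkap hrho _ _ _ _ hb hb1) as hy.
fold (step A) in hy; fold (step (step A)) in hy.
assert (hcp : forall x, continuous (fun r => prim r (step A r)) x)
  by (intros x; apply prim_continuous, hA1).
pose proof (proj1 hb) as hcb; pose proof (proj1 hb1) as hcb1.
pose proof (proj1 hA1) as hc1.
set (X := fun r => r * (/ 2 * (react r (A r) * step A r) - prim r (step A r))).
assert (hX : ex_RInt X 0 rho) by (apply ex_RInt_cont; intros x; unfold X; cont).
assert (hup : RInt X 0 rho <= dual A).
{ apply RInt_le; [lra | exact hX | |].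
  - apply ex_RInt_cont; intros x; apply dual_integrand_continuous with s, hA.
  - intros r hr; unfold X; apply Rmult_le_compat_l; [lra |].
    pose proof (prim_convex r (A r) (step A r)); lra. }
assert (hdn : dual (step A) = RInt X 0 rho
  + (RInt (fun r => r * react r (step A r) * step A r) 0 rho
    - (/ 2 * RInt (fun r => r * react r (A r) * step A r) 0 rho
      + / 2 * RInt (fun r => r * react r (step A r) * step (step A) r) 0 rho))).
{ rewrite <- !RInt_Rscal by (apply ex_RInt_cont; intros x; cont).
  rewrite <- RInt_Rplus by (apply ex_RInt_cont; intros x; cont).
  rewrite <- RInt_Rminus by (apply ex_RInt_cont; intros x; cont).
  rewrite <- RInt_Rplus by (exact hX || (apply ex_RInt_cont; intros x; cont)).
  apply RInt_Rext; intros r _; unfold X; ring. }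
lra.
Qed.

(** The Legendre transform is nonnegative as [prim r 0 = 0], and the quadratic term
    is at most of order [e]. *)
Lemma dual_ge_small (A : R -> R) (s e : R) :
  0 <= e -> admissible rho A e -> (forall t, 0 <= t <= rho -> step A t <= s) ->
  - (rho ^ 2 * react_lip * s) * e <= dual A.
Proof.
intros he hA hs.
assert (h0 : 0 <= rho) by lra.
pose proof react_lip_pos as hL.
apply Rle_trans with (RInt (fun _ => - (rho * react_lip * s) * e) 0 rho).
{ rewrite RInt_Rconst; right; ring. }
apply RInt_le; [lra | apply ex_RInt_const | |].
{ apply ex_RInt_cont; intros x; apply dual_integrand_continuous with e, hA. }
intros r hr.
pose proof (step_nonneg A e r hA) as hst.
destruct hA as [_ hA].
pose proof (prim_convex r (A r) 0) as hc; rewrite prim_0 in hc.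
pose proof (react_bounds r (A r) e ltac:(lra) (hA r ltac:(lra))) as hb.
assert (hp : react r (A r) * step A r <= react_lip * e * s)
  by (apply Rmult_le_compat; try apply hs; lra).
assert (hp0 : 0 <= react r (A r) * step A r) by (apply Rmult_le_pos; lra).
apply Rle_trans with (r * - (react_lip * e * s)).
- assert (0 <= react_lip * e * s) by lra.
  assert (r * (react_lip * e * s) <= rho * (react_lip * e * s))
    by (apply Rmult_le_compat_r; lra).
  lra.
- apply Rmult_le_compat_l; lra.
Qed.

(** Folding the tent at its apex turns the weight [r] into the constant [rho]. *)
Lemma RInt_tent (H : R -> R) (h : R) : (forall x, continuous H x) ->
  RInt (fun r => r * H (tent rho h r)) 0 rho
    = rho * RInt (fun u => H (2 * h / rho * u)) 0 (rho / 2).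
Proof.
intros hH; set (c := 2 * h / rho).
assert (hHc : forall x, continuous (fun u => H (c * u)) x).
{ intros x; apply (continuous_comp (fun u => c * u) H); [cont | apply hH]. }
assert (hHt : forall x, continuous (fun r => H (tent rho h r)) x).
{ intros x; apply (continuous_comp (tent rho h) H); [apply tent_continuous | apply hH]. }
assert (hex : forall a b, ex_RInt (fun r => r * H (tent rho h r)) a b)
  by (intros; apply ex_RInt_cont; intros x; cont).
rewrite (RInt_RChasles _ 0 (rho / 2) rho) by apply hex.
rewrite (RInt_Rext _ (fun u => u * H (c * u)) 0).
2:{ rewrite Rmin_left, Rmax_right by lra; intros x hx.
    rewrite tent_left by lra; reflexivity. }
assert (hr : RInt (fun r => r * H (tent rho h r)) (rho / 2) rho
  = RInt (fun u => (rho - u) * H (c * u)) 0 (rho / 2)).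
{ assert (hc : forall x, continuous (fun u => (rho - u) * H (c * u)) x)
    by (intros x; cont).
  pose proof (RInt_comp_lin (V := R_CompleteNormedModule)
    (fun u => (rho - u) * H (c * u)) (-1) rho (rho / 2) rho
    (ex_RInt_cont _ _ _ hc)) as hl.
  replace (-1 * (rho / 2) + rho) with (rho / 2) in hl by field.
  replace (-1 * rho + rho) with 0 in hl by ring.
  pose proof (opp_RInt_swap (V := R_CompleteNormedModule)
    (fun u => (rho - u) * H (c * u)) 0 (rho / 2) (ex_RInt_cont _ _ _ hc)) as hs.
  rewrite <- hl in hs.
  change (- RInt (fun u => (rho - u) * H (c * u)) 0 (rho / 2)
    = RInt (fun y => -1 * ((rho - (-1 * y + rho)) * H (c * (-1 * y + rho))))
        (rho / 2) rho) in hs.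
  rewrite RInt_Rscal in hs.
  - replace (RInt (fun u => (rho - u) * H (c * u)) 0 (rho / 2))
      with (RInt (fun y => (rho - (-1 * y + rho)) * H (c * (-1 * y + rho)))
        (rho / 2) rho) by lra.
    apply RInt_Rext; rewrite Rmin_left, Rmax_right by lra; intros x hx.
    rewrite tent_right by lra; fold c.
    replace (-1 * x + rho) with (rho - x) by ring; ring.
  - apply ex_RInt_cont; intros x.
    apply (continuous_comp (fun y => -1 * y + rho) (fun u => (rho - u) * H (c * u)));
      [cont | apply hc]. }
rewrite hr, <- RInt_Rplus by (apply ex_RInt_cont; intros x; cont).
rewrite <- RInt_Rscal by apply ex_RInt_cont, hHc.
apply RInt_Rext; intros x _; ring.
Qed.

(** The function [(t * ln (1 + t ^ 2) - 3 * t + 3 * atan t) / 2] is a primitive of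
    [satF], and equals [t ^ 3 * k t / 2]; this is where [k] comes from. *)
Lemma RInt_energy_density (h : R) : 0 < h ->
  RInt (fun u => / 2 * lam * (2 * h / rho * u) ^ 2 - satF (2 * h / rho * u)) 0 (rho / 2)
    = rho * h ^ 2 * (lam / 12 - k h / 4).
Proof.
intros hh; set (c := 2 * h / rho).
assert (hc : 0 < c) by (apply Rdiv_lt_0_compat; lra).
set (P := fun u => / c * (lam * (c * u) ^ 3 / 6
  - / 2 * (c * u * ln (1 + (c * u) ^ 2) - 3 * (c * u) + 3 * atan (c * u)))).
replace (rho * h ^ 2 * (lam / 12 - k h / 4)) with (P (rho / 2) - P 0).
- apply is_RInt_unique, (is_RInt_derive P).
  + intros u _; unfold P, satF; pose proof (pow2_ge_0 (c * u)).
    auto_derive; [simpl in *; lra |].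
    replace (c * u * (c * u * 1)) with ((c * u) ^ 2) by ring.
    field; split; [nra | lra].
  + intros u _.
    apply (continuous_comp (fun u => c * u) (fun a => / 2 * lam * a ^ 2 - satF a)).
    { cont. }
    apply (continuous_minus (fun a => / 2 * lam * a ^ 2) satF).
    { cont. }
    apply (ex_derive_continuous satF); eexists; apply satF_derive.
- unfold P, k; rewrite !Rmult_0_r, atan_0.
  replace (c * (rho / 2)) with h by (unfold c; field; lra).
  unfold c; field; split; lra.
Qed.

(** By [tent_young], [dual] is at most the action on the tent: the terms in [pot]
    cancel, and the action is the one computed by folding. *)
Lemma dual_tent_neg (h : R) : 0 < h -> lam < 3 / 2 * k h ->
  12 * (1 + INR n ^ 2 * (2 * ln 2 - 1)) / lam <= rho ^ 2 ->
  dual (tent rho h) < 0.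
Proof.
intros hh hk hR; set (T := tent rho h).
assert (hT : admissible rho T h)
  by (split; [apply tent_continuous | intros t ht; apply tent_bounds; lra]).
pose proof (react_admissible T h hT) as hb.
pose proof (tent_young n (lam + 1) rho hn hkap hrho h _ _ ltac:(lra) hb) as hy.
fold (step T) in hy; fold T in hy.
assert (hcs : forall x, continuous (step T) x)
  by (intros x; apply step_continuous with h, hT).
pose proof (proj1 hb) as hcb; pose proof (proj1 hT) as hcT.
assert (hcp : forall x, continuous (fun r => prim r (T r)) x)
  by (intros x; apply prim_continuous, hT).
pose proof (pot_continuous n (lam + 1)) as hpc.
set (H := fun a => / 2 * lam * a ^ 2 - satF a).
assert (hH : forall x, continuous H x).
{ intros x; apply (continuous_minus (fun a => / 2 * lam * a ^ 2) satF);
    [cont | apply (ex_derive_continuous satF); eexists; apply satF_derive]. }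
assert (hHT : forall x, continuous (fun r => H (T r)) x)
  by (intros x; apply (continuous_comp T H); [apply hcT | apply hH]).
assert (he : dual T
  = RInt (fun r => r * react r (T r) * T r) 0 rho
    + RInt (fun r => r * H (T r)) 0 rho
    - (/ 2 * RInt (fun r => r * pot n (lam + 1) r * T r ^ 2) 0 rho
      + / 2 * RInt (fun r => r * react r (T r) * step T r) 0 rho)).
{ rewrite <- !RInt_Rscal by (apply ex_RInt_cont; intros x; cont).
  rewrite <- !RInt_Rplus by (apply ex_RInt_cont; intros x; cont).
  rewrite <- RInt_Rminus by (apply ex_RInt_cont; intros x; cont).
  apply RInt_Rext; intros r _; unfold H, prim, T; field. }
assert (hen : rho ^ 2 * h ^ 2 * (lam / 12 - k h / 4)
  = RInt (fun r => r * H (T r)) 0 rho).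
{ unfold T; rewrite RInt_tent by exact hH.
  unfold H; rewrite RInt_energy_density by exact hh; ring. }
apply (proj1 (Rle_div_l _ _ _ hlam)) in hR.
assert (hh2 : 0 < h ^ 2) by (apply pow_lt; exact hh).
assert (hr2 : 0 < rho ^ 2) by (apply pow_lt; exact hrho).
set (m1 := 1 + INR n ^ 2 * (2 * ln 2 - 1)) in *.
assert (h ^ 2 * m1 <= h ^ 2 * (rho ^ 2 * lam / 12))
  by (apply Rmult_le_compat_l; lra).
assert (h ^ 2 * rho ^ 2 * (lam / 6 - k h / 4) < 0).
{ assert (0 < h ^ 2 * rho ^ 2) by (apply Rmult_lt_0_compat; assumption).
  nra. }
lra.
Qed.

(** * The monotone iteration and its limit *)

(** Pointwise convergence at the nodes of a grid of step [e / (3 * (L + 1))]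
    controls the functions in between. *)
Lemma uniform_cv_of_lipschitz (u : nat -> R -> R) (v : R -> R) (L e : R) :
  (forall j x y, Rabs (u j x - u j y) <= L * Rabs (x - y)) ->
  (forall x y, Rabs (v x - v y) <= L * Rabs (x - y)) ->
  (forall x, is_lim_seq (fun j => u j x) (v x)) -> 0 < e ->
  exists N, forall x, 0 <= x <= rho -> Rabs (u N x - v x) <= e.
Proof.
intros hu hv hlim he.
assert (hL : 0 <= L).
{ pose proof (hv 1 0) as h; pose proof (Rabs_pos (v 1 - v 0)).
  rewrite Rminus_0_r, Rabs_R1 in h; lra. }
set (d := e / (3 * (L + 1))).
assert (hd : 0 < d) by (apply Rdiv_lt_0_compat; lra).
assert (hLd : L * d <= e / 3).
{ replace (e / 3) with ((L + 1) * d) by (unfold d; field; lra).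
  apply Rmult_le_compat_r; lra. }
assert (hpt : forall x, exists N, forall j, (N <= j)%nat -> Rabs (u j x - v x) <= e / 3).
{ intros x; assert (he3 : 0 < e / 3) by lra.
  destruct (proj1 (filterlim_locally _ _) (hlim x) (mkposreal _ he3)) as [N hN].
  exists N; intros j hj; left; exact (hN j hj). }
assert (hgrid : forall i : nat, exists N, forall j, (N <= j)%nat ->
  forall x, 0 <= x <= INR i * d -> Rabs (u j x - v x) <= e).
{ induction i as [| i [N1 IH]].
  - destruct (hpt 0) as [N hN]; exists N; intros j hj x hx.
    replace x with 0 by (simpl in hx; lra).
    specialize (hN j hj); lra.
  - destruct (hpt (INR i * d)) as [N2 hN2]; exists (Nat.max N1 N2).
    intros j hj x hx; destruct (Rle_or_lt x (INR i * d)) as [hxi | hxi].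
    + apply IH; [lia | lra].
    + rewrite S_INR in hx.
      assert (hxd : L * Rabs (x - INR i * d) <= e / 3).
      { apply Rle_trans with (2 := hLd), Rmult_le_compat_l; [exact hL |].
        rewrite Rabs_pos_eq; lra. }
      pose proof (hu j x (INR i * d)) as h1; pose proof (hv x (INR i * d)) as h2.
      pose proof (hN2 j ltac:(lia)) as h3.
      apply Rle_trans with (1 := h1) in hxd as h4.
      apply Rle_trans with (1 := h2) in hxd as h5.
      apply Rabs_le_between in h3, h4, h5; apply Rabs_le; lra. }
destruct (INR_unbounded (rho / d)) as [i hi].
destruct (hgrid i) as [N hN]; exists N; intros x hx; apply hN; [lia |].
apply Rgt_lt, Rlt_div_l in hi; lra.
Qed.

Definition iterate (A : R -> R) (j : nat) : R -> R := Nat.iter j step A.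

Lemma iterate_admissible (A : R -> R) (s : R) (j : nat) :
  0 <= s -> 1 <= lam * (1 + s ^ 2) ->
  admissible rho A s -> admissible rho (iterate A j) s.
Proof.
intros hs hbig hA; induction j as [| j IH]; [exact hA |].
apply step_admissible; assumption.
Qed.

Lemma iterate_le (A1 A2 : R -> R) (s : R) (j : nat) (t : R) :
  0 <= s -> 1 <= lam * (1 + s ^ 2) ->
  admissible rho A1 s -> admissible rho A2 s ->
  (forall t, 0 <= t <= rho -> A1 t <= A2 t) ->
  0 <= t <= rho -> iterate A1 j t <= iterate A2 j t.
Proof.
intros hs hbig h1 h2 hle; revert t; induction j as [| j IH]; [exact hle |].
intros t ht; apply step_le; [| | exact IH]; apply (iterate_admissible _ s); assumption.
Qed.

Lemma dual_iterate_le (A : R -> R) (s : R) (j : nat) :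
  0 <= s -> 1 <= lam * (1 + s ^ 2) ->
  admissible rho A s -> dual (iterate A j) <= dual A.
Proof.
intros hs hbig hA; induction j as [| j IH]; [apply Rle_refl |].
apply Rle_trans with (2 := IH), dual_step_le with s.
- apply iterate_admissible; assumption.
- apply (iterate_admissible A s (S j)); assumption.
Qed.

(** Continuity of [step] from above, for the uniform norm: [green] is additive and
    maps the constant [c] to at most [c * rho ^ 2]. *)
Lemma step_plus_small (A1 A2 : R -> R) (e r : R) :
  0 <= e -> (forall x, continuous A1 x) -> (forall x, continuous A2 x) ->
  (forall t, 0 <= t <= rho -> A1 t <= A2 t + e) ->
  step A1 r <= step A2 r + react_lip * rho ^ 2 * e.
Proof.
intros he h1 h2 hle; pose proof react_lip_pos as hL.
assert (hLe : 0 <= react_lip * e) by (apply Rmult_le_pos; lra).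
assert (hc : forall x : R, continuous (fun _ : R => react_lip * e) x) by (intros x; cont).
assert (hc2 : forall x, continuous (fun t => react t (A2 t)) x)
  by (intros x; apply react_continuous, h2).
apply Rle_trans with
  (green n (lam + 1) rho (fun t => react t (A2 t) + react_lip * e) r).
- apply green_le; try assumption.
  + intros x; apply react_continuous, h1.
  + intros x; cont.
  + intros t ht.
    apply Rle_trans with (react t (A2 t + e)); [apply react_incr, hle, ht |].
    pose proof (react_le_lip t (A2 t) (A2 t + e) ht ltac:(lra)); lra.
- rewrite green_plus by assumption; apply Rplus_le_compat_l.
  assert (hlast : 0 <= react_lip * rho ^ 2 * e).
  { replace (react_lip * rho ^ 2 * e) with (react_lip * e * rho ^ 2) by ring.
    apply Rmult_le_pos; [exact hLe | apply pow2_ge_0]. }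
  destruct (Rle_or_lt r 0) as [hr | hr]; [rewrite green_outside; lra |].
  destruct (Rle_or_lt rho r) as [hr' | hr']; [rewrite green_outside; lra |].
  eapply Rle_trans; [apply green_bound with (B := react_lip * e) |]; try assumption.
  + intros t _; lra.
  + lra.
  + replace (react_lip * rho ^ 2 * e) with (react_lip * e * (rho * rho)) by ring.
    rewrite Rmult_assoc; apply Rmult_le_compat_l; [exact hLe |].
    apply Rmult_le_compat; lra.
Qed.

Lemma is_lim_seq_Rle (u v : nat -> R) (a b : R) :
  (forall j, u j <= v j) -> is_lim_seq u a -> is_lim_seq v b -> a <= b.
Proof. intros h hu hv; exact (is_lim_seq_le u v a b h hu hv). Qed.

(** The fixed point is the limit of the decreasing iterates of a supersolution [s]
    that lies above the tent. *)
Lemma fixed_point_exists (h : R) : 0 < h -> dual (tent rho h) < 0 ->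
  exists A s, admissible rho A s /\ (forall r, A r = step A r) /\
    exists r0, 0 < r0 < rho /\ 0 < A r0.
Proof.
intros hh hneg; set (s := h + 1 + / lam).
assert (hil : 0 < / lam) by (apply Rinv_0_lt_compat; exact hlam).
assert (hs : 0 <= s) by (unfold s; lra).
assert (hbig : 1 <= lam * (1 + s ^ 2)).
{ apply Rle_trans with (lam * / lam); [right; field; lra |].
  apply Rmult_le_compat_l; [lra |].
  assert (s <= s ^ 2) by (assert (1 <= s) by (unfold s; lra); simpl; nra).
  unfold s in *; lra. }
assert (hcst : admissible rho (fun _ => s) s)
  by (split; [intros x; cont | intros; lra]).
assert (hT : admissible rho (tent rho h) s).
{ split; [apply tent_continuous |]; intros t ht.
  pose proof (tent_bounds rho hrho h t ltac:(lra) ht); unfold s; lra. }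
(* The indices start at 1 so that every term is a value of [step], to which
   [step_lipschitz] and [step_nonneg] apply. *)
set (up := fun j => iterate (fun _ => s) (S j)).
assert (hup : forall j, admissible rho (up j) s)
  by (intros j; apply (iterate_admissible _ s (S j)); assumption).
assert (hdecr : forall j r, up (S j) r <= up j r).
{ assert (hle : forall j t, 0 <= t <= rho ->
    iterate (fun _ => s) (S j) t <= iterate (fun _ => s) j t).
  { induction j as [| j IH]; intros t ht.
    - apply (step_admissible (fun _ => s) s hs hbig hcst), ht.
    - apply step_le; [apply hup | | exact IH].
      apply (iterate_admissible _ s j); assumption. }
  intros j r; apply step_le; [apply hup | | apply hle].
  apply (iterate_admissible _ s j); assumption. }
assert (hnn : forall j r, 0 <= up j r).
{ intros j r; apply (step_nonneg (iterate (fun _ => s) j) s).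
  apply iterate_admissible; assumption. }
set (A := fun r => real (Lim_seq (fun j => up j r))).
assert (hlim : forall r, is_lim_seq (fun j => up j r) (A r)).
{ intros r; apply Lim_seq_correct', (ex_finite_lim_seq_decr _ 0);
    intros j; [apply hdecr | apply hnn]. }
assert (hAle : forall j r, A r <= up j r).
{ intros j r; apply (is_lim_seq_decr_compare (fun j => up j r)); [apply hlim |].
  intros i; apply hdecr. }
assert (hA0 : forall r, 0 <= A r).
{ intros r; apply is_lim_seq_Rle with (fun _ => 0) (fun j => up j r);
    [intros j; apply hnn | apply is_lim_seq_const | apply hlim]. }
set (L := green_lip n (lam + 1) rho (react_lip * s)).
assert (hlip : forall j x y, Rabs (up j x - up j y) <= L * Rabs (x - y)).
{ intros j x y; apply (step_lipschitz (iterate (fun _ => s) j) s).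
  apply iterate_admissible; assumption. }
assert (hAlip : forall x y, Rabs (A x - A y) <= L * Rabs (x - y)).
{ intros x y; apply is_lim_seq_Rle with
    (fun j => Rabs (up j x - up j y)) (fun _ => L * Rabs (x - y)).
  - intros j; apply hlip.
  - apply (is_lim_seq_abs _ (Finite (A x - A y))), is_lim_seq_minus'; apply hlim.
  - apply is_lim_seq_const. }
assert (hAc : forall x, continuous A x)
  by (intros x; apply lipschitz_continuous with L, hAlip).
assert (hAadm : admissible rho A s).
{ split; [exact hAc |]; intros t ht; split; [apply hA0 |].
  apply Rle_trans with (1 := hAle O t), (hup O), ht. }
assert (hunif : forall e, 0 < e -> exists j, forall t, 0 <= t <= rho -> up j t <= A t + e).
{ intros e he.
  destruct (uniform_cv_of_lipschitz up A L e hlip hAlip hlim he) as [j hj].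
  exists j; intros t ht; specialize (hj t ht); apply Rabs_le_between in hj; lra. }
pose proof react_lip_pos as hLr.
assert (hfix : forall r, A r = step A r).
{ intros r; apply Rle_antisym.
  - set (C := react_lip * rho ^ 2).
    assert (hC : 0 < C) by (apply Rmult_lt_0_compat; [lra | apply pow_lt; lra]).
    apply le_epsilon; intros e he.
    assert (heC : 0 < e / C) by (apply Rdiv_lt_0_compat; lra).
    destruct (hunif (e / C) heC) as [j hj].
    apply Rle_trans with (1 := hAle (S j) r).
    pose proof (step_plus_small (up j) A (e / C) r ltac:(lra) (proj1 (hup j)) hAc hj)
      as hstep.
    fold C in hstep; replace (C * (e / C)) with e in hstep by (field; lra).
    exact hstep.
  - apply is_lim_seq_Rle with (fun _ => step A r) (fun j => up (S j) r).
    + intros j; apply step_le; [exact hAc | apply hup | intros t _; apply hAle].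
    + apply is_lim_seq_const.
    + apply (is_lim_seq_incr_1 (fun j => up j r)), hlim. }
exists A, s; split; [exact hAadm | split; [exact hfix |]].
apply NNPP; intros hno.
assert (hzero : forall t, A t = 0).
{ intros t; destruct (Rle_or_lt t 0) as [ht | ht].
  { rewrite hfix; apply green_outside; lra. }
  destruct (Rle_or_lt rho t) as [ht' | ht'].
  { rewrite hfix; apply green_outside; lra. }
  apply Rle_antisym; [| apply hA0].
  apply Rnot_lt_le; intros hpos; apply hno; exists t; lra. }
set (C := rho ^ 2 * react_lip * s).
assert (hC : 0 < C).
{ repeat apply Rmult_lt_0_compat; try lra; unfold s; lra. }
set (e := - dual (tent rho h) / (2 * C)).
assert (he : 0 < e) by (apply Rdiv_lt_0_compat; lra).
destruct (hunif e he) as [j hj].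
set (T := iterate (tent rho h) (S j)).
assert (hTs : admissible rho T s) by (apply (iterate_admissible _ s (S j)); assumption).
assert (hTe : admissible rho T e).
{ split; [apply hTs |]; intros t ht; split; [apply hTs, ht |].
  apply Rle_trans with (up j t).
  - apply (iterate_le _ _ s); try assumption; intros x hx; apply hT, hx.
  - specialize (hj t ht); rewrite hzero in hj; lra. }
assert (hlow : - C * e <= dual T).
{ apply dual_ge_small; [lra | exact hTe |].
  intros t ht; apply (step_admissible T s hs hbig hTs), ht. }
assert (hhigh : dual T <= dual (tent rho h))
  by (apply (dual_iterate_le _ s (S j)); assumption).
replace (- C * e) with (dual (tent rho h) / 2) in hlow by (unfold e; field; lra).
lra.
Qed.

End Nonlinear.

(** * The boundary value problem *)

Theorem theorem3p1 (m : Z) (lambda rho : R)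
  (hm : (1 <= Z.abs m)%Z)
  (hlambda : 0 < lambda < 3 / 2 * kmax)
  (hrho : 0 < rho)
  (hrho2 : 12 * (1 + (IZR m) ^ 2 * (2 * ln 2 - 1)) / lambda <= rho ^ 2) :
  exists A : R -> R,
    solution_pair m rho A lambda /\ (forall r, 0 < r < rho -> 0 < A r).
Proof.
set (n := Z.abs_nat m).
assert (hn : (1 <= n)%nat) by (unfold n; lia).
assert (hnm : IZR m ^ 2 = INR n ^ 2).
{ unfold n; rewrite INR_IZR_INZ, Zabs2Nat.id_abs, abs_IZR; symmetry; apply pow2_abs. }
rewrite hnm in hrho2.
destruct kmax_is_maximum as [[b0 [hb0 hk0]] _].
assert (hh : exists h, 0 < h /\ lambda < 3 / 2 * k h).
{ destruct (Rle_or_lt b0 0).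
  - exists (- b0); rewrite k_even by exact hb0; lra.
  - exists b0; lra. }
destruct hh as [h [hh hkh]].
destruct (fixed_point_exists n lambda rho hn (proj1 hlambda) hrho h hh
  (dual_tent_neg n lambda rho hn (proj1 hlambda) hrho h hh hkh hrho2))
  as [A [s [hA [hfix [r0 [hr0 hA0]]]]]].
set (b := fun r => react n lambda r (A r)).
assert (hkap : 0 <= lambda + 1) by lra.
destruct (react_admissible n lambda rho hn (proj1 hlambda) A s hA) as [hb hB].
fold b in hb, hB.
assert (hbpos : forall t, 0 <= t <= rho -> 0 <= b t) by (intros t ht; apply hB, ht).
assert (hb0' : 0 < b r0).
{ unfold b, react.
  assert (0 <= sat (A r0)).
  { apply Rmult_le_pos; [apply pow_le; lra |].
    left; apply Rinv_0_lt_compat, pow_lt; nra. }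
  pose proof (pot_ge n lambda hn (proj1 hlambda) r0).
  assert (0 < (pot n (lambda + 1) r0 - lambda) * A r0)
    by (apply Rmult_lt_0_compat; lra).
  lra. }
set (G := green n (lambda + 1) rho b).
assert (hAG : forall r, A r = G r) by exact hfix.
exists G; split.
- split; [| split; [| split; [| split]]].
  + intros x _ P hP.
    apply filter_le_within, (green_continuous n (lambda + 1) rho hn hkap hrho b _ x hb hB).
    exact hP.
  + intros r hr; split; apply (green_solves n (lambda + 1) rho hn hrho b r hb hr).
  + intros r hr.
    destruct (green_solves n (lambda + 1) rho hn hrho b r hb hr) as [_ [_ h2]].
    fold G in h2; rewrite hnm.
    unfold b at 1, react, sat in h2; rewrite hAG in h2; rewrite <- h2; ring.
  + apply green_outside; lra.
  + apply green_outside; lra.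
- intros r hr; apply (green_pos n (lambda + 1) rho hrho b r r0); assumption.
Qed.
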